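(* If either $1<q\le p\le 2$ or $2\le p\le q<\infty$, then the dual space of $H^s_{p,q}(\mathbb{R})$ identifies with $H^s_{p',q'}(\mathbb{R})$, where $\frac1p+\frac1{p'}=\frac1q+\frac1{q'}=1$.
   Context: Setting: for $n\in\mathbb{N}=\{0,1,2,\dots\}$, $\mathcal{F}_n$ is the $\sigma$-algebra on $\mathbb{R}$ generated by the dyadic intervals $[k2^{-n},(k+1)2^{-n})$, $k\in\mathbb{Z}$; $\mathcal{F}$ is the $\sigma$-algebra generated by $\bigcup_n\mathcal{F}_n$; $\mathbb{P}$ is a probability measure on $(\mathbb{R},\mathcal{F})$; $\mathbb{E}_n$ is conditional expectation given $\mathcal{F}_n$. Put $A_j=[j,j+1)$, $j\in\mathbb{Z}$. $\mathcal{M}$ is the set of all martingales $f=(f_n)_{n\ge0}$ with respect to $(\mathcal{F}_n)_{n\ge0}$, with the convention $f_0=0$; $d_nf=f_n-f_{n-1}$ for $n\ge1$ and $d_0f=0$. Amalgam norm: $\|f\|_{L_{p,q}(\mathbb{R})}=\left(\sum_{j\in\mathbb{Z}}\left(\int_{\mathbb{R}}|f|^p\mathbf{1}_{A_j}\,d\mathbb{P}\right)^{q/p}\right)^{1/q}$ for $0<p,q<\infty$. With $s(f)=\left(\sum_{n\in\mathbb{N}}\mathbb{E}_{n-1}|d_nf|^2\right)^{1/2}$ (the $n=0$ term is $0$), $H^s_{p,q}(\mathbb{R})$ is the space of all $f\in\mathcal{M}$ such that $s(f)\in L_{p,q}(\mathbb{R})$, with (quasi-)norm $\|f\|_{H^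s_{p,q}(\mathbb{R})}:=\|s(f)\|_{L_{p,q}(\mathbb{R})}$.
   Formalization: Martingales are required to be integrable on each A_j rather than globally integrable; with global integrability the claim fails for some P when 1<q<p≤2, since H^s_{p',q'} would then be too small to represent the whole dual. *)

(* Defs.v *)
From HB Require Import structures.
From mathcomp Require Import all_boot all_order all_algebra.
From mathcomp Require Import all_classical all_reals all_analysis measurable_realfun.
Import Order.TTheory GRing.Theory Num.Theory.
Import numFieldNormedType.Exports.

Set Implicit Arguments.
Unset Strict Implicit.
Unset Printing Implicit Defensive.

Local Open Scope classical_set_scope.
Local Open Scope ring_scope.

Section DyadicFiltration.
Context (R : realType).

Definition dyadic_itv (n : nat) (k : int) : set R :=
  `[k%:~R * 2 ^- n, (k + 1)%:~R * 2 ^- n[%classic.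

Definition dyadic_itvs (n : nat) : set (set R) := range (dyadic_itv n).

Definition unit_itv (j : int) : set R := `[j%:~R, (j + 1)%:~R[%classic.

(* The real line with the sigma-algebra F_n. *)
Definition dyadic_line (n : nat) : measurableType _ :=
  g_sigma_algebraType (dyadic_itvs n).

Definition dyadic_measurable (n : nat) : set (set R) :=
  @measurable _ (dyadic_line n).

(* The real line with the sigma-algebra F generated by all the F_n. *)
Definition full_line : measurableType _ :=
  g_sigma_algebraType (\bigcup_n dyadic_measurable n).

End DyadicFiltration.

Section HardyAmalgam.
Context (R : realType) (P : probability (full_line R) R).

Local Open Scope ereal_scope.

(* [g] is a version of E_n[h].  The integral identity is required on all the
   sets of F_n over which [h] is integrable, which makes sense as soon as [h]
   is sigma-integrable with respect to F_n; when [h] is integrable it is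
   required on all the sets of F_n, as usual. *)
Definition is_cond_exp (n : nat) (h g : full_line R -> \bar R) : Prop :=
  measurable_fun [set: dyadic_line R n] (g : dyadic_line R n -> \bar R) /\
  forall A : set R, dyadic_measurable n A ->
    P.-integrable A h ->
    \int[P]_(x in A) g x = \int[P]_(x in A) h x.

(* An arbitrary version of E_n[h], chosen nonnegative when [h] is. *)
Definition cond_exp (n : nat) (h : full_line R -> \bar R) :
    full_line R -> \bar R :=
  xget (cst 0) [set g | is_cond_exp n h g /\
                        ((forall x, 0 <= h x) -> forall x, 0 <= g x)].

Definition process := nat -> full_line R -> R.

(* Integrability is required on each A_j, i.e. conditionally on F_0: this is
   what is needed for the conditional expectations E_n to make sense. Global
   integrability is not implied by s(f) being in L_{p,q} when p < q, and the
   spaces H^s_{p,q} would in general not be complete if it were imposed. *)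
Definition martingale (f : process) : Prop :=
  [/\ f 0%N = cst 0%R,
      forall n, measurable_fun [set: dyadic_line R n]
                               (f n : dyadic_line R n -> R),
      forall n j, P.-integrable (unit_itv j) (EFin \o f n) &
      forall n m, (n <= m)%N -> is_cond_exp n (EFin \o f m) (EFin \o f n)].

Definition mdiff (f : process) (n : nat) (x : full_line R) : R :=
  if n is m.+1 then (f m.+1 x - f m x)%R else 0%R.

Definition cond_sqfun (f : process) (x : full_line R) : \bar R :=
  sqrte (\sum_(1 <= n <oo)
           cond_exp n.-1 (fun y => (`|mdiff f n y| ^+ 2)%:E) x).

Definition amalgam_norm (p q : R) (h : full_line R -> \bar R) : \bar R :=
  (\esum_(j in [set: int])
     (\int[P]_(x in unit_itv j) (`|h x| `^ p)) `^ (q / p)) `^ q^-1.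

Definition Hs_norm (p q : R) (f : process) : \bar R :=
  amalgam_norm p q (cond_sqfun f).

Definition Hs (p q : R) : set process :=
  [set f | martingale f /\ Hs_norm p q f < +oo].

(* Elements of the dual of [Hs p q] are represented by functions on all
   processes, only the restriction of which to [Hs p q] is relevant. *)
Definition Hs_dual (p q : R) : set (process -> R) :=
  [set L | (forall (a : R) f g, Hs p q f -> Hs p q g ->
              L (fun n x => a * f n x + g n x)%R = (a * L f + L g)%R) /\
           exists C : R, forall f, Hs p q f ->
              `|L f|%:E <= C%:E * Hs_norm p q f].

Definition Hs_dual_norm (p q : R) (L : process -> R) : \bar R :=
  ereal_sup [set `|L f|%:E | f in [set f | Hs p q f /\ Hs_norm p q f <= 1]].

(* E[\sum_n d_n f d_n g], computed termwise: the first clause of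
   [Hs_dual_identifies_with] makes sum and expectation exchangeable. *)
Definition mpairing (g f : process) : R :=
  limn (series (fun n : nat =>
    Rintegral P [set: full_line R] (fun x => mdiff f n x * mdiff g n x)%R)).

Definition indistinct (g h : process) : Prop :=
  forall n, {ae P, forall x, g n x = h n x}.

(* The dual space of H^s_{p,q} identifies with H^s_{r,t}: the map
   g |-> mpairing g is a well-defined linear bijection from H^s_{r,t} (modulo
   almost everywhere equality) onto the dual of H^s_{p,q}, and it is a
   homeomorphism. *)
Definition Hs_dual_identifies_with (p q r t : R) : Prop :=
  [/\ (* the series defining the pairing is absolutely convergent *)
      forall f g, Hs p q f -> Hs r t g ->
        \sum_(0 <= n <oo) \int[P]_x `|mdiff f n x * mdiff g n x|%:E < +oo,
      forall g, Hs r t g -> Hs_dual p q (mpairing g),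
      forall (a : R) g h f, Hs r t g -> Hs r t h -> Hs p q f ->
        mpairing (fun n x => a * g n x + h n x)%R f =
        (a * mpairing g f + mpairing h f)%R,
      (forall L, Hs_dual p q L ->
        exists2 g, Hs r t g & forall f, Hs p q f -> L f = mpairing g f) /\
      (forall g h, Hs r t g -> Hs r t h ->
        (forall f, Hs p q f -> mpairing g f = mpairing h f) ->
        indistinct g h) &
      exists c C : R, [/\ (0 < c)%R, (0 < C)%R & forall g, Hs r t g ->
        c%:E * Hs_norm r t g <= Hs_dual_norm p q (mpairing g) /\
        Hs_dual_norm p q (mpairing g) <= C%:E * Hs_norm r t g]].

End HardyAmalgam.

(* Main.v *)
(** Every [F_n] is generated by the atoms [dyadic_itv n k], so a martingale is
    given, up to null sets, by one coefficient [c n k] per dyadic interval: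
    [d_{n+1} f = c n k * haar n] on [dyadic_itv n k], where [haar n] is the
    unnormalised Haar function.  Then [E_n |d_{n+1} f|^2] is
    [c n k ^+ 2 * haar_var n k] and [E_n (d_{n+1} f * d_{n+1} g)] is
    [c n k * d n k * haar_var n k], so that the pairing is bounded by the
    Cauchy-Schwarz and Hoelder inequalities.

    Conversely, let [L] be a functional and [c] the coefficients defined by its
    values on the Haar functions.  With [s_n] the partial sums of the
    conditional square function of [c] truncated to finitely many intervals,
    [r = p'], [t = q'] and [N_j] the [L_r] norm of the truncated square function
    on [A_j], the martingale [f] with coefficients [N_j^(t-r) s_n^(r-2) c]
    satisfies [L f >= e * sum_j N_j^t] and
    [||f||_{p,q} <= C * (sum_j N_j^t)^(1/q)], because
    [x^(b-1) (x - y)] is comparable to [x^b - y^b] for [0 <= y <= x] and every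
    [b > 0] (used with [b = r/2] and [b = r - 1]).  Hence the norm of [c] in
    [H^s_{r,t}] is controlled by that of [L]; [L] is the pairing with [c] since
    finite Haar sums are dense. *)

From mathcomp Require Import all_boot all_order all_algebra.
From mathcomp Require Import all_classical all_reals all_analysis measurable_realfun.
From mathcomp Require Import zify ring lra.
(* After MathComp-Analysis, which also has a [dyadic_itv]. *)
Require Import Defs.
Import Order.TTheory GRing.Theory Num.Theory.
Import numFieldNormedType.Exports.

Set Implicit Arguments.
Unset Strict Implicit.
Unset Printing Implicit Defensive.

Local Open Scope classical_set_scope.
Local Open Scope ring_scope.

(** * Power inequalities *)

Section PowerInequalities.
Context {R : realType}.
Implicit Types (a b p q x y z : R).

(** Hoelder duality suggests testing [L] on coefficients [s ^ (r - 2) * c], with [s] the full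
    conditional square function of [c]. They are not admissible: [s] depends on all later levels,
    whereas a coefficient of level [n] must be constant on the intervals of that level. The partial
    sum up to and including term [n] is constant there, since the [n]-th term of the conditional
    square function is itself F_n-measurable; hence [s_n]. The price is that summing [T ^ (b - 1)]
    against the increments of [T] gives [T ^ b] only up to constants, so norms are compared up to a
    factor. Two exponents occur because the value of [L] is linear in the weight [T ^ (r / 2 - 1)],
    while the square function of the test martingale is quadratic in it. Nothing is known beforehand
    about the norm of [c], so every test martingale is a finite Haar sum, and its normalisation
    involves finite quantities only. On null dyadic intervals martingales and versions of
    conditional expectations are arbitrary. They are confined to one null set, the complement of the
    [regular] points. *)

Lemma powR_bernoulli b z : 1 <= b -> 0 <= z -> 1 - z `^ b <= b * (1 - z).
Proof.
move=> b1 z0; have b0 : 0 < b by exact: lt_le_trans b1.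
have [b1' | b1'] := eqVneq b 1; first by rewrite b1' powRr1// mul1r.
have bb : b^-1 < 1 by rewrite invf_lt1// lt_neqAle eq_sym b1' b1.
(* Young's inequality for the product [z * 1], with exponents [b] and its conjugate. *)
have := @conjugate_powR _ z 1 b (1 - b^-1)^-1 z0 ler01 b0.
rewrite invrK invr_gt0 subr_gt0 => /(_ bb); rewrite addrC subrK => /(_ erefl).
rewrite powR1 mul1r mulr1 => h.
have : b * z <= z `^ b + (b - 1).
  have -> : z `^ b + (b - 1) = b * (z `^ b / b + (1 - b^-1)).
    by field; rewrite gt_eqF.
  by rewrite ler_pM2l.
by rewrite mulrBr mulr1; lra.
Qed.

(** Both sides are homogeneous of degree [b], so only [z = y / x] matters. One inequality is
    monotonicity of powers on [[0, 1]]. The other is Bernoulli's, at [z] with exponent [b] if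
    [b >= 1], and at [z ^ b] with exponent [1 / b] otherwise. *)
Lemma powR_increment b : 0 < b -> exists c C, [/\ 0 < c, 0 < C &
  forall x y, 0 <= y <= x -> c * (x `^ b - y `^ b) <= x `^ (b - 1) * (x - y) /\
    x `^ (b - 1) * (x - y) <= C * (x `^ b - y `^ b)].
Proof.
move=> b0.
suff [c [C [c0 C0 H]]] : exists c C, [/\ 0 < c, 0 < C & forall z, 0 <= z <= 1 ->
    c * (1 - z `^ b) <= 1 - z /\ 1 - z <= C * (1 - z `^ b)].
  exists c, C; split => // x y /andP[y0 yx].
  have [x0|x0] := eqVneq x 0.
    have -> : y = x by apply/eqP; rewrite eq_le yx x0.
    by rewrite !subrr !mulr0.
  have xp : 0 < x by rewrite lt_neqAle eq_sym x0 (le_trans y0).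
  have xE : x `^ (b - 1) * x = x `^ b by rewrite mulrC mulr_powRB1// ltW.
  have /H[h1 h2] : 0 <= y / x <= 1 by rewrite divr_ge0 ?(ltW xp)//= ler_pdivrMr ?mul1r.
  have yE : y = y / x * x by rewrite divfK.
  have ybE : y `^ b = (y / x) `^ b * x `^ b by rewrite {1}yE powRM ?divr_ge0 ?(ltW xp).
  have -> : x `^ (b - 1) * (x - y) = x `^ b * (1 - y / x).
    by rewrite -xE; field.
  have -> : x `^ b - y `^ b = x `^ b * (1 - (y / x) `^ b) by rewrite ybE; ring.
  by rewrite !(mulrCA _ (x `^ b)) !ler_pM2l ?powR_gt0.
have zb z : 0 <= z <= 1 -> (b <= 1 -> z <= z `^ b) /\ (1 <= b -> z `^ b <= z).
  move=> /andP[z0 z1]; have [->|zn0] := eqVneq z 0.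
    by rewrite powR0 ?gt_eqF.
  have zp : 0 < z <= 1 by rewrite z1 lt_neqAle eq_sym zn0 z0.
  by split => ?; [exact: ger1_powR|exact: ge1r_powR].
have [b1|b1] := leP 1 b.
  exists b^-1, 1; split; rewrite ?invr_gt0// => z z01.
  rewrite mul1r lerD2l lerN2 ((zb z z01).2 b1) ler_pdivrMl//; split => //.
  by apply: powR_bernoulli => //; case/andP: z01.
exists 1, b^-1; split; rewrite ?invr_gt0// => z z01.
rewrite mul1r lerD2l lerN2 ((zb z z01).1 (ltW b1)); split => //.
have b1' : 1 <= b^-1 by rewrite invf_ge1// ltW.
have := powR_bernoulli b1' (powR_ge0 z b).
by rewrite -powRrM divff ?gt_eqF// powRr1//; case/andP: z01.
Qed.

(** Telescoping of [T n.+1 ^ b - T n ^ b]: a discrete counterpart of integrating [T ^ (b - 1)]. The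
    constants do not depend on [u] or [N]. *)
Lemma powR_increment_sum b : 0 < b -> exists c C, [/\ 0 < c, 0 < C &
  forall (u : nat -> R) N, (forall n, 0 <= u n) ->
   let T n := \sum_(i < n) u i in
   c * T N `^ b <= \sum_(n < N) T n.+1 `^ (b - 1) * u n /\
   \sum_(n < N) T n.+1 `^ (b - 1) * u n <= C * T N `^ b].
Proof.
move=> b0; have [c [C [c0 C0 H]]] := powR_increment b0.
exists c, C; split => // u N u0 T.
have T0 n : 0 <= T n by apply: sumr_ge0 => i _; exact: u0.
have TS n : T n.+1 = T n + u n by rewrite /T big_ord_recr.
have TH n : 0 <= T n <= T n.+1 by rewrite T0 TS lerDl u0.
have TN : \sum_(n < N) (T n.+1 `^ b - T n `^ b) = T N `^ b.
  elim: N => [|N IH]; last by rewrite big_ord_recr /= IH addrCA subrr addr0.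
  by rewrite /T !big_ord0 powR0 ?gt_eqF.
have uE n : u n = T n.+1 - T n by rewrite TS addrAC subrr add0r.
rewrite -TN !mulr_sumr; split; apply: ler_sum => n _; rewrite uE.
  exact: (H _ _ (TH n)).1.
exact: (H _ _ (TH n)).2.
Qed.

Lemma hoelder_seq (I : Type) (s : seq I) (u v : I -> R) p q :
  (forall i, 0 <= u i) -> (forall i, 0 <= v i) ->
  0 < p -> 0 < q -> p^-1 + q^-1 = 1 ->
  \sum_(i <- s) u i * v i <=
  (\sum_(i <- s) u i `^ p) `^ p^-1 * (\sum_(i <- s) v i `^ q) `^ q^-1.
Proof.
move=> u0 v0 p0 q0 pq; elim: s => [|i s IH].
  by rewrite !big_nil mulr_ge0 ?powR_ge0.
rewrite !big_cons.
set B := \sum_(j <- s) u j `^ p in IH *.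
set C := \sum_(j <- s) v j `^ q in IH *.
have B0 : 0 <= B by apply: sumr_ge0 => j _; exact: powR_ge0.
have C0 : 0 <= C by apply: sumr_ge0 => j _; exact: powR_ge0.
clearbody B C.
have := @hoelder2 R (u i) (B `^ p^-1) (v i) (C `^ q^-1) p q (u0 i) (powR_ge0 _ _) (v0 i) (powR_ge0 _ _) p0 q0 pq.
have powK (x r : R) : 0 <= x -> 0 < r -> (x `^ r^-1) `^ r = x.
  by move=> x0 r0; rewrite -powRrM mulVf ?gt_eqF// powRr1.
rewrite (powK B p B0 p0) (powK C q C0 q0).
by apply: le_trans; rewrite lerD2l.
Qed.

Lemma cauchy_schwarz_seq (I : Type) (s : seq I) (u v : I -> R) :
  \sum_(i <- s) `|u i * v i| <=
  Num.sqrt (\sum_(i <- s) u i ^+ 2) * Num.sqrt (\sum_(i <- s) v i ^+ 2).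
Proof.
under eq_bigr do rewrite normrM.
have h2 : 2^-1 + 2^-1 = 1 :> R by rewrite -[2^-1]div1r -splitr.
have := @hoelder_seq I s (fun i => `|u i|) (fun i => `|v i|) 2 2
  (fun i => normr_ge0 _) (fun i => normr_ge0 _) (ltr0Sn _ _) (ltr0Sn _ _) h2.
under [X in _ <= X `^ _ * _]eq_bigr do rewrite -[2]/(2%:R) powR_mulrn// real_normK ?num_real//.
under [X in _ <= _ * X `^ _]eq_bigr do rewrite -[2]/(2%:R) powR_mulrn// real_normK ?num_real//.
by rewrite !powR12_sqrt// sumr_ge0// => i _; exact: sqr_ge0.
Qed.

End PowerInequalities.

(** * Sums over arbitrary index types and limits of powers in the extended reals *)

Section ExtendedSums.
Context {R : realType}.
Local Open Scope ereal_scope.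

Lemma esum_le_seq (I : choiceType) (a : I -> \bar R) (M : \bar R) :
  (forall s : seq I, uniq s -> \sum_(i <- s) a i <= M) ->
  \esum_(i in [set: I]) a i <= M.
Proof.
move=> H; apply: ge_ereal_sup => _ [X [finX _] <-].
by rewrite fsbig_finite//=; apply: H; exact: finmap.fset_uniq.
Qed.

Lemma seq_le_esum (I : choiceType) (a : I -> \bar R) (s : seq I) : uniq s ->
  \sum_(i <- s) a i <= \esum_(i in [set: I]) a i.
Proof.
move=> us; apply: esum_ge; exists [set` s]; first by split.
by rewrite fsbig_seq.
Qed.

(** The limit may be [+oo], so the argument goes through suprema: a real [s] below [l ^ b] satisfies
    [s ^ (1 / b) < l], and some [u n] exceeds [s ^ (1 / b)]. *)
Lemma nondecreasing_poweR_cvg (u : nat -> \bar R) (l : \bar R) (b : R) :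
  (0 < b)%R -> (forall n, 0 <= u n) -> nondecreasing_seq u ->
  u @ \oo --> l -> (fun n => u n `^ b) @ \oo --> l `^ b.
Proof.
move=> b0 u0 ndu ul.
have lE : l = ereal_sup (range u).
  by rewrite -(cvg_lim _ (ereal_nondecreasing_cvgn ndu))// (cvg_lim _ ul).
have mono (x y : \bar R) : 0 <= x -> x <= y -> x `^ b <= y `^ b.
  move=> x0 xy; apply: gt0_ler_poweR => //; first exact: ltW.
    by rewrite in_itv /= x0 leey.
  by rewrite in_itv /= (le_trans x0 xy) leey.
have ndub : nondecreasing_seq (fun n => u n `^ b).
  by move=> m n mn; apply: mono => //; exact: ndu.
have := ereal_nondecreasing_cvgn ndub.
suff -> : ereal_sup (range (fun n => u n `^ b)) = l `^ b by [].
apply/eqP; rewrite eq_le; apply/andP; split.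
  apply: ge_ereal_sup => _ [n _ <-]; apply: mono => //.
  by rewrite lE; apply: ereal_sup_ubound; exists n.
have l0 : 0 <= l by rewrite lE (le_trans (u0 0%N))//; apply: ereal_sup_ubound; exists 0%N.
rewrite leNgt; apply/negP => h.
have S0 : 0 <= ereal_sup (range (fun n => u n `^ b)).
  by apply: le_trans (poweR_ge0 (u 0%N) b) _; apply: ereal_sup_ubound; exists 0%N.
move: h S0; case ES : (ereal_sup _) => [s| |]; last 2 first.
- by rewrite ltNge leey.
- by [].
rewrite lee_fin => sl s0.
have : (s `^ b^-1)%:E < l.
  rewrite ltNge; apply/negP => ls.
  have := mono _ _ l0 ls; rewrite poweR_EFin -powRrM mulVf ?gt_eqF// powRr1//.
  by rewrite leNgt sl.
rewrite lE => /ereal_sup_gt[_ [n _ <-]] sun.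
have : u n `^ b <= s%:E by rewrite -ES; apply: ereal_sup_ubound; exists n.
rewrite leNgt => /negP; apply.
have : s%:E = (s `^ b^-1)%:E `^ b by rewrite poweR_EFin -powRrM mulVf ?gt_eqF// powRr1.
move=> ->; move: sun; case: (u n) => [w| |].
- rewrite lte_fin !poweR_EFin lte_fin => sw.
  by apply: gt0_ltr_powR => //; rewrite nnegrE ?powR_ge0// (le_trans _ (ltW sw))// powR_ge0.
- by move=> _; rewrite poweRyr ?gt_eqF// poweR_EFin ltry.
- by [].
Qed.

End ExtendedSums.

(** * Dyadic intervals *)

Section Dyadic.
Context {R : realType}.
Implicit Types (n m i : nat) (k j : int) (x y : R).

(** Membership in a dyadic interval becomes an equation between integers, and [dyadic_point] (the
    left endpoint) serves as canonical representative of the interval. *)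
Definition dyadic_index n x : int := Num.floor (x * 2 ^+ n).
Definition dyadic_point n k : R := k%:~R * 2 ^- n.

Local Notation kn := dyadic_index.
Local Notation pt := dyadic_point.

Lemma dyadic_itvE n k : dyadic_itv n k = [set x : R | kn n x = k].
Proof.
apply/seteqP; split => x /=; rewrite /dyadic_itv /= in_itv /=.
  move=> /andP[h1 h2]; apply: floor_def.
  by rewrite -ler_pdivrMr ?exprn_gt0// h1 -ltr_pdivlMr ?exprn_gt0.
move=> /esym kE; have := floor_itv (x * 2 ^+ n).
rewrite -/(kn n x) -kE => /andP[h1 h2].
by rewrite ler_pdivrMr ?exprn_gt0// h1 ltr_pdivlMr ?exprn_gt0.
Qed.

Lemma unit_itvE j : unit_itv j = @dyadic_itv R 0 j.
Proof. by rewrite /unit_itv /dyadic_itv expr0 invr1 !mulr1. Qed.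

Lemma dyadic_pointK n k : kn n (pt n k) = k.
Proof. by rewrite /kn /pt mulfVK ?expf_neq0// intrKfloor. Qed.

Lemma dyadic_indexS n x :
  kn n.+1 x = 2 * kn n x \/ kn n.+1 x = 2 * kn n x + 1.
Proof.
have /andP[h1 h2] := floor_itv (x * 2 ^+ n).
have /andP[h3 h4] := floor_itv (x * 2 ^+ n.+1).
rewrite -!/(kn _ _) in h1 h2 h3 h4.
rewrite exprS mulrCA in h3 h4.
have h5 : (kn n.+1 x)%:~R < (2 * (kn n x + 1))%:~R :> R.
  by rewrite intrM; lra.
have h6 : (2 * kn n x)%:~R < (kn n.+1 x + 1)%:~R :> R.
  by rewrite intrM; lra.
move: h5 h6; rewrite !ltr_int => h5 h6; lia.
Qed.

Lemma dyadic_indexS_half n x y : kn n.+1 x = kn n.+1 y -> kn n x = kn n y.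
Proof. by case: (dyadic_indexS n x) => ->; case: (dyadic_indexS n y) => ->; lia. Qed.

Lemma dyadic_index_le n i x y : (i <= n)%N -> kn n x = kn n y -> kn i x = kn i y.
Proof.
move=> /subnK <-; elim: (n - i)%N => // d IH; rewrite addSn => /dyadic_indexS_half.
exact: IH.
Qed.

Lemma dyadic_index_left n k : kn n (pt n.+1 (2 * k)) = k.
Proof. by have := dyadic_indexS n (pt n.+1 (2 * k)); rewrite dyadic_pointK; lia. Qed.

Lemma dyadic_index_right n k : kn n (pt n.+1 (2 * k + 1)) = k.
Proof. by have := dyadic_indexS n (pt n.+1 (2 * k + 1)); rewrite dyadic_pointK; lia. Qed.

Lemma dyadic_itvS n k : @dyadic_itv R n k =
  dyadic_itv n.+1 (2 * k) `|` dyadic_itv n.+1 (2 * k + 1).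
Proof.
rewrite !dyadic_itvE; apply/seteqP; split => x /=.
  by have := dyadic_indexS n x; lia.
by have := dyadic_indexS n x; lia.
Qed.

Lemma dyadic_itv_disjoint n k j : k <> j ->
  [disjoint @dyadic_itv R n k & dyadic_itv n j].
Proof.
move=> kj; rewrite !dyadic_itvE; apply/disj_setPS => x /= [kx jx].
by apply: kj; rewrite -kx -jx.
Qed.

(** Sets that do not separate points of the same level-[n] interval form a sigma-algebra containing
    the generators. *)
Lemma dyadic_measurableE n A : dyadic_measurable n A ->
  forall x y, kn n x = kn n y -> A x -> A y.
Proof.
move=> mA.
pose G : set (set R) := [set B | forall x y, kn n x = kn n y -> B x -> B y].
suff : dyadic_measurable n `<=` G by move/(_ _ mA).
apply: smallest_sub.
  split.
  - by move=> x y.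
  - move=> B GB x y xy [_ Bx]; split => // By; apply: Bx; exact: (GB y x).
  - by move=> F GF x y xy [i _ Fx]; exists i => //; exact: (GF i x y).
move=> _ [k _ <-] x y xy; by rewrite dyadic_itvE /= xy.
Qed.

Lemma dyadic_itv_dyadic_measurable n k : dyadic_measurable n (@dyadic_itv R n k).
Proof. by apply: sub_sigma_algebra; exists k. Qed.

Arguments dyadic_itv_dyadic_measurable : clear implicits.

Lemma dyadic_measurable_full n A : dyadic_measurable n A ->
  measurable (A : set (full_line R)).
Proof. by move=> mA; apply: sub_sigma_algebra; exists n. Qed.

Lemma dyadic_itv_measurable n k :
  measurable (dyadic_itv n k : set (full_line R)).
Proof. exact: (dyadic_measurable_full (dyadic_itv_dyadic_measurable n k)). Qed.

(** Such a set is the union of the intervals whose left endpoint it contains, and [int] is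
    countable. *)
Lemma dyadic_measurableP n (A : set R) :
  (forall x y, kn n x = kn n y -> A x -> A y) -> dyadic_measurable n A.
Proof.
move=> H.
have -> : A = \bigcup_(k in [set k | A (pt n k)]) dyadic_itv n k.
  apply/seteqP; split => x.
    move=> Ax; exists (kn n x); last by rewrite dyadic_itvE.
    by apply: H Ax; rewrite dyadic_pointK.
  by move=> [k /= Ak]; rewrite dyadic_itvE /= => kE; apply: H Ak; rewrite dyadic_pointK.
rewrite bigcup_mkcond.
apply: (@countable_bigcupT_measurable _ (dyadic_line R n)).
  exact: countableP.
move=> k.
case: ifP => _; first exact: dyadic_itv_dyadic_measurable.
exact: (@measurable0 _ (dyadic_line R n)).
Qed.

Lemma dyadic_fun_measurable d (T : measurableType d) n (f : R -> T) :
  (forall x y, kn n x = kn n y -> f x = f y) ->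
  measurable_fun [set: dyadic_line R n] (f : dyadic_line R n -> T).
Proof.
move=> H _ B mB; rewrite setTI; apply: dyadic_measurableP => x y xy /=.
by rewrite (H _ _ xy).
Qed.

Lemma dyadic_fun_full d (T : measurableType d) n (f : R -> T) :
  measurable_fun [set: dyadic_line R n] (f : dyadic_line R n -> T) ->
  measurable_fun [set: full_line R] (f : full_line R -> T).
Proof.
move=> mf _ B mB; rewrite setTI.
apply: (@dyadic_measurable_full n).
by have := mf measurableT B mB; rewrite setTI.
Qed.

Lemma dyadic_fun_full_measurable d (T : measurableType d) n (f : R -> T) :
  (forall x y, kn n x = kn n y -> f x = f y) ->
  measurable_fun [set: full_line R] (f : full_line R -> T).
Proof. move=> H; exact: (dyadic_fun_full (dyadic_fun_measurable H)). Qed.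

Lemma dyadic_fun_cst d (T : measurableType d) n (f : R -> T) :
  (forall t : T, measurable [set t]) ->
  measurable_fun [set: dyadic_line R n] (f : dyadic_line R n -> T) ->
  forall x y, kn n x = kn n y -> f x = f y.
Proof.
move=> m1 mf x y xy.
have := mf measurableT [set f x] (m1 _); rewrite setTI => m.
by have /= := dyadic_measurableE m xy erefl.
Qed.

(** The level-[n] intervals listed along [nat], as countable additivity requires; numbers that
    encode no integer give the empty set. *)
Definition dyadic_atom n i : set R :=
  if @pickle_inv int i is Some k then dyadic_itv n k else set0.

Lemma dyadic_atom_measurable n i : measurable (dyadic_atom n i : set (full_line R)).
Proof.
rewrite /dyadic_atom; case: pickle_inv => [k|]; last exact: measurable0.
exact: dyadic_itv_measurable.
Qed.

Lemma trivIset_dyadic_atom n : trivIset setT (dyadic_atom n).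
Proof.
apply/trivIsetP => i i' _ _ /eqP ii'.
rewrite /dyadic_atom; case Ei : (pickle_inv i) => [k|]; last by rewrite set0I.
case Ei' : (pickle_inv i') => [k'|]; last by rewrite setI0.
rewrite !dyadic_itvE -subset0 => x /= [kE k'E]; apply: ii'.
have := pickle_invK (T:=int) i; have := pickle_invK (T:=int) i'.
by rewrite /oapp Ei Ei' -kE -k'E => -> ->.
Qed.

Lemma bigcup_dyadic_atom n : \bigcup_i dyadic_atom n i = setT.
Proof.
apply/seteqP; split => x; first exact.
move=> _; exists (pickle (kn n x)); first exact: I.
by rewrite /dyadic_atom pickleK_inv dyadic_itvE.
Qed.

End Dyadic.

(** * Integrals over dyadic intervals *)

Section AtomIntegrals.
Context {R : realType} (P : probability (full_line R) R).
Implicit Types (n m i : nat) (k j : int) (x y : R).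

Local Notation kn := dyadic_index.
Local Notation pt := dyadic_point.
Local Notation itv n k := (@dyadic_itv R n k : set (full_line R)).

Definition mass n k : R := fine (P (itv n k)).

Lemma massE n k : P (itv n k) = (mass n k)%:E.
Proof. by rewrite /mass fineK// fin_num_measure//; exact: dyadic_itv_measurable. Qed.

Lemma mass_ge0 n k : 0 <= mass n k.
Proof. by rewrite -lee_fin -massE measure_ge0. Qed.

Lemma massS n k : mass n k = mass n.+1 (2 * k) + mass n.+1 (2 * k + 1).
Proof.
apply: EFin_inj; rewrite EFinD -!massE dyadic_itvS measureU//; try exact: dyadic_itv_measurable.
by apply/eqP; rewrite -disj_set2E; apply: dyadic_itv_disjoint; lia.
Qed.

Lemma integral_dyadic_partition n (A : set (full_line R)) (h : full_line R -> \bar R) :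
  measurable A -> measurable_fun A h -> (forall x, A x -> 0 <= h x)%E ->
  (\int[P]_(x in A) h x = \sum_(i <oo) \int[P]_(x in A `&` dyadic_atom n i) h x)%E.
Proof.
move=> mA mh h0.
have AE : A = \bigcup_i (A `&` dyadic_atom n i).
  by rewrite -setI_bigcupr bigcup_dyadic_atom setIT.
rewrite [in LHS]AE ge0_integral_bigcup//; try by rewrite -AE.
  by move=> i; apply: measurableI => //; exact: dyadic_atom_measurable.
apply: trivIset_setIl; exact: trivIset_dyadic_atom.
Qed.

Lemma setI_dyadic_atom n (A : set R) i : dyadic_measurable n A ->
  A `&` dyadic_atom n i = set0 \/
  exists2 k, A `&` dyadic_atom n i = dyadic_itv n k & dyadic_itv n k `<=` A.
Proof.
move=> mA; rewrite /dyadic_atom; case: pickle_inv => [k|]; last by left; rewrite setI0.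
have [Ak|Ak] := pselect (A (pt n k)); [right|left].
  have kA : dyadic_itv n k `<=` A.
    move=> x; rewrite dyadic_itvE /= => xk.
    by apply: (dyadic_measurableE mA) Ak; rewrite dyadic_pointK.
  by exists k => //; rewrite setIC; exact/setIidPl.
rewrite -subset0 => x [Ax]; rewrite dyadic_itvE /= => xk; apply: Ak.
by apply: (dyadic_measurableE mA) Ax; rewrite dyadic_pointK.
Qed.

Lemma le_integral_dyadic n (A : set (full_line R)) (h1 h2 : full_line R -> \bar R) :
  dyadic_measurable n A ->
  measurable_fun setT h1 -> measurable_fun setT h2 ->
  (forall x, 0 <= h1 x)%E -> (forall x, 0 <= h2 x)%E ->
  (forall k, dyadic_itv n k `<=` A ->
    \int[P]_(x in itv n k) h1 x <= \int[P]_(x in itv n k) h2 x)%E ->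
  (\int[P]_(x in A) h1 x <= \int[P]_(x in A) h2 x)%E.
Proof.
move=> mA mh1 mh2 h10 h20 h12.
have mA' := dyadic_measurable_full mA.
rewrite !(@integral_dyadic_partition n)//; try exact: measurable_funTS.
apply: lee_nneseries => [i _ _|i _]; first exact: integral_ge0.
have [->|[k -> kA]] := setI_dyadic_atom i mA; first by rewrite !integral_set0.
exact: h12.
Qed.

Lemma eq_integral_dyadic n (A : set (full_line R)) (h1 h2 : full_line R -> \bar R) :
  dyadic_measurable n A ->
  measurable_fun setT h1 -> measurable_fun setT h2 ->
  (forall x, 0 <= h1 x)%E -> (forall x, 0 <= h2 x)%E ->
  (forall k, dyadic_itv n k `<=` A ->
    \int[P]_(x in itv n k) h1 x = \int[P]_(x in itv n k) h2 x)%E ->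
  (\int[P]_(x in A) h1 x = \int[P]_(x in A) h2 x)%E.
Proof.
move=> mA mh1 mh2 h10 h20 h12; apply/eqP; rewrite eq_le; apply/andP; split.
  by apply: (le_integral_dyadic mA) => // k /h12 ->.
by apply: (le_integral_dyadic mA) => // k /h12 ->.
Qed.

(** For signed functions countable additivity needs integrability on both sides; the comparison of
    absolute integrals on the atoms transfers it from [h2] to [h1]. *)
Lemma eq_integral_dyadic_integrable n (A : set (full_line R)) (h1 h2 : full_line R -> \bar R) :
  dyadic_measurable n A ->
  measurable_fun setT h1 -> measurable_fun setT h2 ->
  P.-integrable A h2 ->
  (forall k, dyadic_itv n k `<=` A ->
    \int[P]_(x in itv n k) `|h1 x| <= \int[P]_(x in itv n k) `|h2 x|)%E ->
  (forall k, dyadic_itv n k `<=` A ->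
    \int[P]_(x in itv n k) h1 x = \int[P]_(x in itv n k) h2 x)%E ->
  (\int[P]_(x in A) h1 x = \int[P]_(x in A) h2 x)%E.
Proof.
move=> mA mh1 mh2 ih2 le12 eq12.
have mA' := dyadic_measurable_full mA.
have ih1 : P.-integrable A h1.
  apply/integrableP; split; first exact: measurable_funTS.
  have /integrableP[_] := ih2; apply: le_lt_trans.
  by apply: (le_integral_dyadic mA) => //; exact: measurableT_comp.
have AE : A = \bigcup_i (A `&` dyadic_atom n i).
  by rewrite -setI_bigcupr bigcup_dyadic_atom setIT.
have mAi i : measurable (A `&` dyadic_atom n i : set (full_line R)).
  by apply: measurableI => //; exact: dyadic_atom_measurable.
have tA : trivIset setT (fun i => A `&` dyadic_atom n i).
  by apply: trivIset_setIl; exact: trivIset_dyadic_atom.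
rewrite AE !integral_bigcup//; try by rewrite -AE.
apply: eq_eseriesr => i _.
have [->|[k -> kA]] := setI_dyadic_atom i mA; first by rewrite !integral_set0.
exact: eq12.
Qed.

Lemma integral_dyadic_itv_cst n k (h : full_line R -> \bar R) r :
  (forall x, kn n x = k -> h x = r) ->
  (\int[P]_(x in itv n k) h x = r * (mass n k)%:E)%E.
Proof.
move=> hE; rewrite (eq_integral (cst r)).
  by rewrite -massE integral_cst//; exact: dyadic_itv_measurable.
by move=> x; rewrite inE dyadic_itvE => /hE.
Qed.

Lemma integral_dyadic_itvS n k (h : full_line R -> \bar R) :
  measurable_fun setT h ->
  (\int[P]_(x in itv n k) h x = \int[P]_(x in itv n.+1 (2 * k)) h x
     + \int[P]_(x in itv n.+1 (2 * k + 1)) h x)%E.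
Proof.
move=> mh; rewrite dyadic_itvS integral_setU//.
- exact: dyadic_itv_measurable.
- exact: dyadic_itv_measurable.
- exact: measurable_funTS.
- by apply: dyadic_itv_disjoint; lia.
Qed.

Lemma dyadic_fun_integrable m n k (h : full_line R -> R) :
  (forall x y, kn m x = kn m y -> h x = h y) -> P.-integrable (itv n k) (EFin \o h).
Proof.
move=> hc; have mh : measurable_fun setT (EFin \o h).
  by apply/measurable_EFinP; exact: (dyadic_fun_full_measurable hc).
(* Halving the interval [e] times reaches level [m], where [h] is constant; so the interval carries
   finitely many values of [h]. *)
suff : forall e n k, (m <= n + e)%N -> P.-integrable (itv n k) (EFin \o h).
  by apply; exact: leq_addl.
elim=> [|e IH] {}n {}k mne; apply/integrableP; (split; first exact: measurable_funTS).
  rewrite (@integral_dyadic_itv_cst _ _ _ `|h (pt n k)|%:E); first by rewrite -EFinM ltry.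
  move=> x xk /=; rewrite (hc x (pt n k))//; apply: (@dyadic_index_le _ n).
    by rewrite addn0 in mne.
  by rewrite dyadic_pointK.
rewrite integral_dyadic_itvS; last exact: measurableT_comp.
rewrite addnS -addSn in mne.
have /integrableP[_ h1] := IH n.+1 (2 * k) mne.
have /integrableP[_ h2] := IH n.+1 (2 * k + 1) mne.
exact: lte_add_pinfty.
Qed.

Lemma integral_unit_itv (h : full_line R -> \bar R) :
  measurable_fun setT h -> (forall x, 0 <= h x)%E ->
  (\int[P]_x h x = \esum_(j in [set: int]) \int[P]_(x in unit_itv j) h x)%E.
Proof.
move=> mh h0; rewrite (@integral_dyadic_partition 0)//.
rewrite nneseries_esumT; last by move=> i; exact: integral_ge0.
transitivity (\esum_(i in pickle @` [set: int]) \int[P]_(x in dyadic_atom 0 i) h x)%E.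
  rewrite [RHS]esum_mkcond; apply: eq_esum => i _; rewrite setTI.
  case: ifPn => // /negP; rewrite inE => iN.
  rewrite /dyadic_atom; case E : (pickle_inv i) => [k|]; last by rewrite integral_set0.
  exfalso; apply: iN; exists k; first exact: I.
  by have := pickle_invK (T:=int) i; rewrite /oapp E.
rewrite esum_image; last by move=> k j _ _; exact: (pcan_inj pickleK).
by apply: eq_esum => j _; rewrite /dyadic_atom pickleK_inv unit_itvE.
Qed.

End AtomIntegrals.

(** * Haar coefficients of martingales *)

Section TreeMartingales.
Context {R : realType} (P : probability (full_line R) R).
Implicit Types (n m i : nat) (k j : int) (x y a : R) (f g : process R)
  (c : nat -> int -> R).

Local Notation kn := dyadic_index.
Local Notation pt := dyadic_point.
Local Notation itv n k := (@dyadic_itv R n k : set (full_line R)).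
Local Notation mass := (mass P).

(** Weighting each child by the mass of its sibling gives mean zero without any division, so null
    intervals need no special case. *)
Definition haar n x : R :=
  if kn n.+1 x == 2 * kn n x then mass n.+1 (2 * kn n x + 1)
  else - mass n.+1 (2 * kn n x).

(** The mean of [haar n ^+ 2] over the interval: if the children have masses [l] and [r], then
    [l * r ^ 2 + r * l ^ 2 = l * r * (l + r)]. *)
Definition haar_var n k : R := mass n.+1 (2 * k) * mass n.+1 (2 * k + 1).

Definition haar_process c : process R :=
  fun n x => \sum_(i < n) c i (kn i x) * haar i x.

(** The pointwise form of [martingale]: F_n-measurability forces constancy on every level-[n]
    interval, even a null one, and the averaging identity is free of division. *)
Definition tree_martingale f : Prop :=
  [/\ f 0%N = cst 0,
      forall n x y, kn n x = kn n y -> f n x = f n y &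
      forall n k, mass n.+1 (2 * k) * f n.+1 (pt n.+1 (2 * k)) +
        mass n.+1 (2 * k + 1) * f n.+1 (pt n.+1 (2 * k + 1)) =
        mass n k * f n (pt n k)].

(** The excluded points lie in one of countably many null intervals. At the remaining ones all
    versions of a conditional expectation coincide. *)
Definition regular x : Prop := forall n, mass n (kn n x) != 0.

Lemma haar_var_ge0 n k : 0 <= haar_var n k.
Proof. by rewrite mulr_ge0// mass_ge0. Qed.

Lemma haar_index n x y : kn n.+1 x = kn n.+1 y -> haar n x = haar n y.
Proof. by move=> xy; rewrite /haar xy (dyadic_indexS_half xy). Qed.

Lemma haar_left n k x : kn n.+1 x = 2 * k -> haar n x = mass n.+1 (2 * k + 1).
Proof.
move=> xk; rewrite /haar xk.
have -> : kn n x = k by have := dyadic_indexS n x; lia.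
by rewrite eqxx.
Qed.

Lemma haar_right n k x : kn n.+1 x = 2 * k + 1 -> haar n x = - mass n.+1 (2 * k).
Proof.
move=> xk; rewrite /haar xk.
have -> : kn n x = k by have := dyadic_indexS n x; lia.
by case: eqP => // ?; lia.
Qed.

Lemma ae_regular : {ae P, forall x, regular x}.
Proof.
apply: ae_foralln => n.
pose F i : set (full_line R) := if P (dyadic_atom n i) == 0 then dyadic_atom n i else set0.
suff [N [mN N0 subN]] : P.-negligible (\bigcup_i F i).
  exists N; split => // x /= /negP/negPn/eqP x0; apply: subN.
  exists (pickle (kn n x)); first exact: I.
  by rewrite /F /dyadic_atom pickleK_inv massE x0 eqxx dyadic_itvE.
apply: negligible_bigcup => i; rewrite /F; case: ifPn => [/eqP P0|_].
  by apply/negligibleP => //; exact: dyadic_atom_measurable.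
exact: negligible_set0.
Qed.

Lemma regular_ae (Q : R -> Prop) : (forall x, regular x -> Q x) -> {ae P, forall x, Q x}.
Proof.
move=> rQ; have [N [mN N0 subN]] := ae_regular.
by exists N; split => // x /= Qx; apply: subN => /= rx; apply: Qx; exact: rQ.
Qed.

Lemma tree_martingale_integral f n d k : tree_martingale f ->
  (\int[P]_(x in itv n k) (f (n + d)%N x)%:E = (mass n k * f n (pt n k))%:E)%E.
Proof.
move=> [_ fc fE]; elim: d n k => [|d IH] n k.
  rewrite addn0 (@integral_dyadic_itv_cst _ _ _ _ _ (f n (pt n k))%:E).
    by rewrite -EFinM mulrC.
  by move=> x xk /=; rewrite (fc _ x (pt n k))// dyadic_pointK.
have := IH n.+1; rewrite addSnnS => {}IH.
rewrite integral_dyadic_itvS ?IH ?IH -?EFinD ?fE//.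
apply: (@dyadic_fun_full_measurable _ _ _ (n + d.+1)) => x y xy /=.
by rewrite (fc _ _ _ xy).
Qed.

Lemma martingale_tree f : martingale P f -> tree_martingale f.
Proof.
move=> [f0 mf intf ce].
have fc n x y : kn n x = kn n y -> f n x = f n y.
  by move=> xy; apply: (@dyadic_fun_cst _ _ _ n (f n) _ (mf n)).
have fm n j x : kn n x = j -> f n x = f n (pt n j).
  by move=> xm; apply: fc; rewrite dyadic_pointK.
split => // n k.
have [_ /(_ (itv n k) (@dyadic_itv_dyadic_measurable R n k))] := ce n n.+1 (leqnSn n).
have intI : P.-integrable (itv n k) (EFin \o f n.+1).
  apply: (@integrableS _ _ _ P (unit_itv (kn 0 (pt n k)))).
  - by rewrite unit_itvE; exact: dyadic_itv_measurable.
  - exact: dyadic_itv_measurable.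
  - move=> x; rewrite unit_itvE !dyadic_itvE /= => xk.
    by apply: (@dyadic_index_le _ n) => //; rewrite dyadic_pointK.
  - exact: intf.
have ie m j : (\int[P]_(x in itv m j) (EFin \o f m) x = (mass m j * f m (pt m j))%:E)%E.
  rewrite (@integral_dyadic_itv_cst _ _ _ _ _ (f m (pt m j))%:E) -?EFinM 1?mulrC//.
  by move=> x xk; rewrite /= (fm _ _ _ xk).
move/(_ intI); rewrite ie integral_dyadic_itvS; first by rewrite !ie -EFinD => -[/esym].
apply: (@dyadic_fun_full_measurable _ _ _ n.+1) => x y xy /=.
by rewrite (fc _ _ _ xy).
Qed.

Lemma tree_martingaleP f : martingale P f <-> tree_martingale f.
Proof.
split; first exact: martingale_tree.
move=> tf; have [f0 fc fE] := tf.
have mf n : measurable_fun setT (EFin \o f n : full_line R -> _).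
  apply: (@dyadic_fun_full_measurable _ _ _ n) => x y xy /=.
  by rewrite (fc _ _ _ xy).
split => //.
- by move=> n; apply: dyadic_fun_measurable; exact: fc.
- by move=> n j; rewrite unit_itvE; exact: (dyadic_fun_integrable P 0 j (@fc n)).
move=> n m nm; split.
  by apply: dyadic_fun_measurable => x y xy /=; rewrite (fc _ _ _ xy).
move=> A mA iA; apply: (@eq_integral_dyadic_integrable _ P n) => //.
(* Conditional Jensen on one interval: [f n] is constant there, and its integral is that of
   [f m]. *)
- move=> k _; have := tree_martingale_integral n (m - n) k tf.
  have := tree_martingale_integral n 0 k tf.
  rewrite addn0 subnKC// => E1 E2.
  rewrite (@integral_dyadic_itv_cst _ _ _ _ _ `|f n (pt n k)|%:E).
    have := le_abse_integral P (dyadic_itv_measurable n k) (measurable_funTS (mf m)).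
    apply: le_trans; rewrite E2 -EFinM lee_fin /= normrM [X in _ <= X * _]ger0_norm ?mass_ge0//.
    by rewrite mulrC.
  by move=> x xk /=; rewrite (fc _ x (pt n k))// dyadic_pointK.
- move=> k _; have := tree_martingale_integral n (m - n) k tf.
  have := tree_martingale_integral n 0 k tf.
  by rewrite addn0 subnKC// => -> ->.
Qed.

Lemma tree_martingale_lin a f g : tree_martingale f -> tree_martingale g ->
  tree_martingale (fun n x => a * f n x + g n x).
Proof.
move=> [f0 fc fE] [g0 gc gE]; split.
- by apply/funext => x; rewrite f0 g0 /= mulr0 addr0.
- by move=> n x y xy; rewrite (fc _ _ _ xy) (gc _ _ _ xy).
- move=> n k; rewrite [RHS](_ : _ = a * (mass n k * f n (pt n k)) + mass n k * g n (pt n k)).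
    by rewrite -fE -gE; ring.
  by ring.
Qed.

Lemma tree_martingale_haar c : tree_martingale (haar_process c).
Proof.
have pc n x y : kn n x = kn n y -> haar_process c n x = haar_process c n y.
  move=> xy; apply: eq_bigr => i _.
  rewrite (dyadic_index_le (ltnW (ltn_ord i)) xy) (@haar_index i x y)//.
  by apply: dyadic_index_le xy.
split => //.
  by apply/funext => x; rewrite /haar_process big_ord0.
move=> n k; rewrite /haar_process !big_ord_recr /=.
rewrite -/(haar_process c n (pt n.+1 (2 * k))) -/(haar_process c n (pt n.+1 (2 * k + 1))).
rewrite (pc n (pt n.+1 (2 * k)) (pt n k)) ?dyadic_index_left ?dyadic_pointK//.
rewrite (pc n (pt n.+1 (2 * k + 1)) (pt n k)) ?dyadic_index_right ?dyadic_pointK//.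
rewrite (@haar_left _ k) ?dyadic_pointK// (@haar_right _ k) ?dyadic_pointK//.
by rewrite -/(haar_process c n (pt n k)) (massS P n k); ring.
Qed.

(** Only regular points are constrained: inside a null interval [haar n] vanishes, while the
    increment of [f] is arbitrary. *)
Definition represents f c : Prop :=
  forall n x, regular x -> mdiff f n.+1 x = c n (kn n x) * haar n x.

Lemma represents_lin a f g c c' : represents f c -> represents g c' ->
  represents (fun n x => a * f n x + g n x) (fun n k => a * c n k + c' n k).
Proof.
move=> fc gc n x rx; rewrite mulrDl -mulrA -fc// -gc//= /mdiff; ring.
Qed.

Lemma represents_haar c : represents (haar_process c) c.
Proof. by move=> n x _; rewrite /= /haar_process big_ord_recr /= addrC addrK. Qed.

(* The left endpoint [dyadic_point n k] lies in the left child, where [haar n]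
   equals [mass n.+1 (2 * k + 1)].  If this mass is 0 then so is the coefficient,
   rightly since the increment of [f] vanishes on the non-null child. *)
Definition haar_coef f n k : R :=
  mdiff f n.+1 (pt n k) / mass n.+1 (2 * k + 1).

(** For children of masses [l], [r] with increments [u], [v], the martingale identity reads
    [l * u + r * v = 0], so [(u, v)] is a multiple of [(r, - l)], the values of [haar n]. *)
Lemma represents_haar_coef f : tree_martingale f -> represents f (haar_coef f).
Proof.
move=> [_ fc fE] n x rx; set k := kn n x.
have {}fE : mass n.+1 (2 * k) * mdiff f n.+1 (pt n.+1 (2 * k)) +
    mass n.+1 (2 * k + 1) * mdiff f n.+1 (pt n.+1 (2 * k + 1)) = 0.
  rewrite /= (fc n (pt n.+1 (2 * k)) (pt n k)) ?dyadic_index_left ?dyadic_pointK//.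
  rewrite (fc n (pt n.+1 (2 * k + 1)) (pt n k)) ?dyadic_index_right ?dyadic_pointK//.
  by rewrite !mulrBr addrACA fE (massS P n k); ring.
have dc y z : kn n.+1 y = kn n.+1 z -> mdiff f n.+1 y = mdiff f n.+1 z.
  by move=> yz /=; rewrite (fc _ _ _ yz) (fc _ _ _ (dyadic_indexS_half yz)).
have ptE : pt n k = pt n.+1 (2 * k) :> R.
  rewrite /dyadic_point intrM (exprS (2 : R)); field.
  by rewrite expf_neq0.
rewrite /haar_coef ptE.
have := rx n.+1.
have [xk|xk] := dyadic_indexS n x; rewrite xk.
  rewrite (@haar_left _ k)// (dc x (pt n.+1 (2 * k))) ?dyadic_pointK// -/k => l0.
  have [r0|r0] := eqVneq (mass n.+1 (2 * k + 1)) 0; last by rewrite divfK.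
  move: fE; rewrite r0 mul0r addr0 mulr0 => /eqP.
  by rewrite mulf_eq0 (negbTE l0) => /eqP.
rewrite (@haar_right _ k)// (dc x (pt n.+1 (2 * k + 1))) ?dyadic_pointK// -/k => r0.
apply: (mulfI r0); rewrite mulrN mulrN mulrA mulrCA divff// mulr1.
by apply/eqP; rewrite -addr_eq0 addrC mulrC mulrC [mdiff _ _ _ * _]mulrC fE.
Qed.

End TreeMartingales.

(** * The Hardy norm in terms of Haar coefficients *)

Section HardyNorm.
Context {R : realType} (P : probability (full_line R) R).
Implicit Types (n m i : nat) (k j : int) (x y a : R) (f g : process R)
  (c d : nat -> int -> R) (b : int -> R).

Local Notation kn := dyadic_index.
Local Notation pt := dyadic_point.
Local Notation itv n k := (@dyadic_itv R n k : set (full_line R)).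
Local Notation mass := (mass P).
Local Notation haar := (haar P).
Local Notation haar_var := (haar_var P).
Local Notation represents := (represents P).
Local Notation regular := (regular P).

(** [cond_exp] is a choice made by [xget], so a witness is needed. The witness [g] averages [h] over
    the interval of [x]; division by 0 makes it 0 on null intervals. *)
Lemma cond_expP n (h : full_line R -> R) :
  measurable_fun setT h -> (forall x, 0 <= h x) ->
  (forall k, P.-integrable (itv n k) (EFin \o h)) ->
  is_cond_exp P n (EFin \o h) (cond_exp P n (EFin \o h)) /\
  (forall x, 0 <= cond_exp P n (EFin \o h) x)%E.
Proof.
move=> mh h0 ih.
have ih0 k : (0 <= \int[P]_(x in itv n k) (EFin \o h) x)%E.
  by apply: integral_ge0 => x _; rewrite lee_fin.
pose g x := (fine (\int[P]_(y in itv n (kn n x)) (EFin \o h) y)%E / mass n (kn n x))%:E.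
have g0 x : (0 <= g x)%E.
  by rewrite lee_fin divr_ge0 ?mass_ge0// fine_ge0.
suff gP : is_cond_exp P n (EFin \o h) g.
  have /(xgetPex (cst 0)) : exists e, is_cond_exp P n (EFin \o h) e /\
      ((forall x, 0 <= (EFin \o h) x)%E -> forall x, 0 <= e x)%E by exists g.
  by move=> [? g0']; split => // x; apply: g0' => y; rewrite lee_fin.
split; first by apply: dyadic_fun_measurable => x y xy; rewrite /g xy.
move=> A mA _; apply: (@eq_integral_dyadic _ P n) => //.
- by apply: (@dyadic_fun_full_measurable _ _ _ n) => x y xy; rewrite /g xy.
- exact/measurable_EFinP.
move=> k _; rewrite (@integral_dyadic_itv_cst _ _ _ _ _ (g (pt n k))); last first.
  by move=> x xk; rewrite /g xk dyadic_pointK.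
rewrite /g dyadic_pointK -EFinM.
have fink : (\int[P]_(x in itv n k) (EFin \o h) x)%E \is a fin_num.
  by apply: integrable_fin_num => //; exact: dyadic_itv_measurable.
have [m0|m0] := eqVneq (mass n k) 0; last by rewrite divfK// fineK.
rewrite m0 invr0 mulr0 null_set_integral//.
- exact: dyadic_itv_measurable.
- by apply/measurable_EFinP; exact: measurable_funTS.
- by have := massE P n k; rewrite m0.
Qed.

(** Any version is constant on the interval, hence determined by its integral there once the mass is
    positive; an infinite value would make that integral infinite. *)
Lemma cond_exp_atom n k (h : full_line R -> R) x r :
  measurable_fun setT h -> (forall x, 0 <= h x) ->
  (forall k, P.-integrable (itv n k) (EFin \o h)) ->
  (\int[P]_(x in itv n k) (h x)%:E = r%:E * (mass n k)%:E)%E ->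
  mass n k != 0 -> kn n x = k ->
  cond_exp P n (EFin \o h) x = r%:E.
Proof.
move=> mh h0 ih hr m0 xk.
have [[mg +] _] := cond_expP mh h0 ih.
move=> /(_ (itv n k) (@dyadic_itv_dyadic_measurable R n k) (ih k)).
rewrite [in RHS]hr (@integral_dyadic_itv_cst _ _ _ _ _ (cond_exp P n (EFin \o h) x)).
  have mp : (0 < (mass n k)%:E)%E by rewrite lte_fin lt_neqAle mass_ge0 eq_sym m0.
  case: (cond_exp _ _ _ _) => [s| |].
  - by rewrite -!EFinM => -[/(mulIf m0) ->].
  - by rewrite gt0_mulye.
  - by rewrite gt0_mulNye.
move=> y yk; apply: (@dyadic_fun_cst R _ _ n _ _ mg); last by rewrite xk.
exact: emeasurable_set1.
Qed.

Lemma haar_full_measurable n : measurable_fun setT (haar n : full_line R -> R).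
Proof.
apply: (@dyadic_fun_full_measurable _ _ _ n.+1) => x y xy; exact: haar_index.
Qed.

Lemma integral_haar_sq n k r :
  (\int[P]_(x in itv n k) (r * haar n x ^+ 2)%:E = (r * haar_var n k * mass n k)%:E)%E.
Proof.
rewrite integral_dyadic_itvS; last first.
  by apply: (@dyadic_fun_full_measurable _ _ _ n.+1) => x y xy; rewrite (haar_index P xy).
rewrite (@integral_dyadic_itv_cst _ _ _ _ _ (r * mass n.+1 (2 * k + 1) ^+ 2)%:E); last first.
  by move=> x xk; rewrite (haar_left P xk).
rewrite (@integral_dyadic_itv_cst _ _ _ _ _ (r * mass n.+1 (2 * k) ^+ 2)%:E); last first.
  by move=> x xk; rewrite (haar_right P xk) sqrrN.
rewrite -!EFinM -EFinD (massS P n k) /haar_var; congr EFin; ring.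
Qed.

(** [b] may change sign and no integrability is available, so the equality is proved for the
    positive and the negative part separately and recombined by [integralE]. *)
Lemma integral_haar_sq_dyadic n b (A : set R) : dyadic_measurable n A ->
  (\int[P]_(x in A) (b (kn n x) * haar n x ^+ 2)%:E =
   \int[P]_(x in A) (b (kn n x) * haar_var n (kn n x))%:E)%E.
Proof.
move=> mA.
have pos b' : (forall k, 0 <= b' k) ->
  (\int[P]_(x in A) (b' (kn n x) * haar n x ^+ 2)%:E =
   \int[P]_(x in A) (b' (kn n x) * haar_var n (kn n x))%:E)%E.
  move=> b'0; apply: (@eq_integral_dyadic _ P n) => //.
  - apply: (@dyadic_fun_full_measurable _ _ _ n.+1) => x y xy.
    by rewrite (haar_index P xy) (dyadic_indexS_half xy).
  - by apply: (@dyadic_fun_full_measurable _ _ _ n) => x y ->.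
  - by move=> x; rewrite lee_fin mulr_ge0// sqr_ge0.
  - by move=> x; rewrite lee_fin mulr_ge0// haar_var_ge0.
  move=> k _; rewrite [RHS](@integral_dyadic_itv_cst _ _ _ _ _ (b' k * haar_var n k)%:E).
    rewrite -EFinM -integral_haar_sq; apply: eq_integral => x.
    by rewrite inE dyadic_itvE /= => ->.
  by move=> x ->.
rewrite integralE [in RHS]integralE.
have maxE (u v : R) : 0 <= v -> (maxe (u * v)%:E 0 = (Num.max u 0 * v)%:E)%E.
  by move=> v0; rewrite -EFin_max maxr_pMl// mul0r.
congr (_ - _)%E.
- rewrite [LHS](eq_integral (fun x : full_line R => (Num.max (b (kn n x)) 0 * haar n x ^+ 2)%:E)); last first.
    by move=> x _; rewrite funeposE maxE// sqr_ge0.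
  rewrite [RHS](eq_integral (fun x : full_line R => (Num.max (b (kn n x)) 0 * haar_var n (kn n x))%:E)); last first.
    by move=> x _; rewrite funeposE maxE// haar_var_ge0.
  by apply: (pos (fun k => Num.max (b k) 0)) => k; rewrite le_max lexx orbT.
- rewrite [LHS](eq_integral (fun x : full_line R => (Num.max (- b (kn n x)) 0 * haar n x ^+ 2)%:E)); last first.
    by move=> x _; rewrite funenegE -EFinN -mulNr maxE// sqr_ge0.
  rewrite [RHS](eq_integral (fun x : full_line R => (Num.max (- b (kn n x)) 0 * haar_var n (kn n x))%:E)); last first.
    by move=> x _; rewrite funenegE -EFinN -mulNr maxE// haar_var_ge0.
  by apply: (pos (fun k => Num.max (- b k) 0)) => k; rewrite le_max lexx orbT.
Qed.

Lemma mdiff_measurable f n : tree_martingale P f ->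
  measurable_fun setT (mdiff f n : full_line R -> R).
Proof.
move=> [f0 fc _]; case: n => [|n]; first exact: measurable_cst.
apply: (@dyadic_fun_full_measurable _ _ _ n.+1) => x y xy /=.
by rewrite (fc _ _ _ xy) (fc _ _ _ (dyadic_indexS_half xy)).
Qed.

Lemma mdiff_cst f n x y : tree_martingale P f -> kn n.+1 x = kn n.+1 y ->
  mdiff f n.+1 x = mdiff f n.+1 y.
Proof.
by move=> [_ fc _] xy; rewrite /= (fc _ _ _ xy) (fc _ _ _ (dyadic_indexS_half xy)).
Qed.

Lemma mdiff_sq_measurable f n : tree_martingale P f ->
  measurable_fun setT (fun x : full_line R => `|mdiff f n x| ^+ 2).
Proof.
move=> tf; apply: measurable_funX; apply: measurableT_comp => //.
exact: mdiff_measurable.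
Qed.

Lemma mdiff_sq_integrable f n k : tree_martingale P f ->
  P.-integrable (itv n.-1 k) (EFin \o (fun x : full_line R => `|mdiff f n x| ^+ 2)).
Proof.
move=> tf; case: n => [|n]; first exact: (@dyadic_fun_integrable _ P 0).
apply: (@dyadic_fun_integrable _ P n.+1) => x y xy.
by rewrite (mdiff_cst tf xy).
Qed.

Lemma cond_exp_mdiff f c n x : tree_martingale P f -> represents f c -> regular x ->
  cond_exp P n (fun y => (`|mdiff f n.+1 y| ^+ 2)%:E) x =
  (c n (kn n x) ^+ 2 * haar_var n (kn n x))%:E.
Proof.
move=> tf fc rx.
apply: (@cond_exp_atom n (kn n x) (fun y : full_line R => `|mdiff f n.+1 y| ^+ 2)) => //.
- exact: mdiff_sq_measurable.
- by move=> k; exact: (@mdiff_sq_integrable f n.+1 k tf).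
rewrite -EFinM -integral_haar_sq; apply: ge0_ae_eq_integral.
- exact: dyadic_itv_measurable.
- by apply: measurable_funTS; apply/measurable_EFinP; exact: mdiff_sq_measurable.
- apply: measurable_funTS; apply/measurable_EFinP; apply: measurable_funM => //.
  by apply: measurable_funX; exact: haar_full_measurable.
- by move=> y _; rewrite lee_fin sqr_ge0.
- by move=> y _; rewrite lee_fin mulr_ge0 ?sqr_ge0.
apply: regular_ae => y ry; rewrite dyadic_itvE /= => yx.
by rewrite -[X in X%:E = _]/(`|mdiff f n.+1 y| ^+ 2) fc// yx real_normK ?num_real// exprMn.
Qed.

Definition sqsum c x : \bar R :=
  (\sum_(n <oo) (c n (kn n x) ^+ 2 * haar_var n (kn n x))%:E)%E.

Lemma sqsum_term_ge0 c n x : 0 <= c n (kn n x) ^+ 2 * haar_var n (kn n x).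
Proof. by rewrite mulr_ge0 ?sqr_ge0 ?haar_var_ge0. Qed.

Lemma sqsum_term_measurable c n :
  measurable_fun setT (fun x : full_line R => c n (kn n x) ^+ 2 * haar_var n (kn n x)).
Proof. by apply: (@dyadic_fun_full_measurable _ _ _ n) => x y ->. Qed.

Lemma sqsum_ge0 c x : (0 <= sqsum c x)%E.
Proof. by apply: nneseries_ge0 => n _ _; rewrite lee_fin sqsum_term_ge0. Qed.

Lemma sqsum_measurable c : measurable_fun setT (sqsum c : full_line R -> \bar R).
Proof.
apply: ge0_emeasurable_sum => [n x _ _|n _]; first by rewrite lee_fin sqsum_term_ge0.
by apply/measurable_EFinP; exact: sqsum_term_measurable.
Qed.

(** The exponent is [p / 2] because [sqsum] corresponds to the square of [cond_sqfun]. *)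
Definition atom_power p c j : \bar R :=
  (\int[P]_(x in unit_itv j) (sqsum c x `^ (p / 2)))%E.

Definition coef_norm p q c : \bar R :=
  ((\esum_(j in [set: int]) (atom_power p c j `^ (q / p))) `^ q^-1)%E.

(** [cond_sqfun] is built from arbitrary versions and is compared with [sqsum] at regular points
    only, which suffices under the integral. [V] is its square, reindexed so that term [n] is
    conditioned on F_n. *)
Lemma Hs_normE p q f c : tree_martingale P f -> represents f c ->
  Hs_norm P p q f = coef_norm p q c.
Proof.
move=> tf fc; rewrite /Hs_norm /amalgam_norm /coef_norm; congr (_ `^ _)%E.
apply: eq_esum => j _; congr (_ `^ _)%E; rewrite /atom_power.
pose V x := (\sum_(n <oo) cond_exp P n (fun y => (`|mdiff f n.+1 y| ^+ 2)%:E) x)%E.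
have ce n := @cond_expP n.-1 _ (mdiff_sq_measurable n tf) (fun x => sqr_ge0 _) (fun k => mdiff_sq_integrable n k tf).
have V0 x : (0 <= V x)%E by apply: nneseries_ge0 => n _ _; have [_ +] := ce n.+1; exact.
have mV : measurable_fun setT (V : full_line R -> \bar R).
  apply: ge0_emeasurable_sum => [n x _ _|n _]; first by have [_ +] := ce n.+1; exact.
  by have [[mc _] _] := ce n.+1; exact: (dyadic_fun_full mc).
have VE x : (`|cond_sqfun P f x| `^ p = V x `^ (p / 2))%E.
  rewrite /cond_sqfun -nneseries_addn; last by move=> n; have [_ +] := ce n; exact.
  rewrite [X in sqrte X](_ : _ = V x); last by apply: eq_eseriesr => n _; rewrite addn1.
  by rewrite -poweR12_sqrt// gee0_abs ?poweR_ge0// -poweRrM mulrC.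
under eq_integral do rewrite VE.
apply: ge0_ae_eq_integral.
- by rewrite unit_itvE; exact: dyadic_itv_measurable.
- by apply: measurable_funTS; exact: (measurableT_comp (measurable_poweR (p / 2)) mV).
- by apply: measurable_funTS; exact: (measurableT_comp (measurable_poweR (p / 2)) (sqsum_measurable c)).
- by move=> x _; exact: poweR_ge0.
- by move=> x _; exact: poweR_ge0.
apply: regular_ae => x rx _; congr (_ `^ _)%E.
by apply: eq_eseriesr => n _; rewrite (cond_exp_mdiff n tf fc rx).
Qed.

Lemma integral_mdiff f g c d n : tree_martingale P f -> tree_martingale P g ->
  represents f c -> represents g d ->
  (\int[P]_x (mdiff f n.+1 x * mdiff g n.+1 x)%:E =
   \int[P]_x (c n (kn n x) * d n (kn n x) * haar_var n (kn n x))%:E)%E.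
Proof.
move=> tf tg fc gd.
rewrite -(@integral_haar_sq_dyadic n (fun k => c n k * d n k)); last first.
  exact: dyadic_measurableP.
apply: ae_eq_integral => //.
- apply/measurable_EFinP; apply: measurable_funM; exact: mdiff_measurable.
- apply/measurable_EFinP; apply: measurable_funM.
    by apply: (@dyadic_fun_full_measurable _ _ _ n) => x y ->.
  by apply: measurable_funX; exact: haar_full_measurable.
apply: regular_ae => x rx _.
by rewrite fc// gd//; congr EFin; ring.
Qed.

Lemma integral_mdiff_abs f g c d n : tree_martingale P f -> tree_martingale P g ->
  represents f c -> represents g d ->
  (\int[P]_x (`|mdiff f n.+1 x * mdiff g n.+1 x|)%:E =
   \int[P]_x (`|c n (kn n x) * d n (kn n x)| * haar_var n (kn n x))%:E)%E.
Proof.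
move=> tf tg fc gd.
rewrite -(@integral_haar_sq_dyadic n (fun k => `|c n k * d n k|)); last first.
  exact: dyadic_measurableP.
apply: ae_eq_integral => //.
- apply/measurable_EFinP; apply: measurableT_comp => //.
  apply: measurable_funM; exact: mdiff_measurable.
- apply/measurable_EFinP; apply: measurable_funM.
    by apply: (@dyadic_fun_full_measurable _ _ _ n) => x y ->.
  by apply: measurable_funX; exact: haar_full_measurable.
apply: regular_ae => x rx _.
by rewrite fc// gd// mulrACA normrM -expr2 [X in _ * X]ger0_norm ?sqr_ge0.
Qed.

End HardyNorm.

(** * Hoelder's inequality on a measurable set *)

Section HoelderOn.
Context d (T : measurableType d) (R : realType) (mu : {measure set T -> \bar R}).
Local Open Scope ereal_scope.

Lemma hoelder_on (A : set T) (f g : T -> R) (p q : R) :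
  measurable A -> measurable_fun setT f -> measurable_fun setT g ->
  (forall x, 0 <= f x)%R -> (forall x, 0 <= g x)%R ->
  (0 < p)%R -> (0 < q)%R -> (p^-1 + q^-1 = 1)%R ->
  \int[mu]_(x in A) (f x * g x)%:E <=
  (\int[mu]_(x in A) (f x `^ p)%:E) `^ p^-1 * (\int[mu]_(x in A) (g x `^ q)%:E) `^ q^-1.
Proof.
move=> mA mf mg f0 g0 p0 q0 pq.
pose f' := (f \_ A)%R; pose g' := (g \_ A)%R.
have mr (h : T -> R) : measurable_fun setT h -> measurable_fun setT (h \_ A)%R.
  by move=> mh; apply/(measurable_restrictT h mA); exact: measurable_funTS.
have := hoelder mu (mr _ mf) (mr _ mg) p0 q0 pq.
have NE (h : T -> R) (r : R) : (forall x, 0 <= h x)%R -> (0 < r)%R ->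
    'N[mu]_r%:E[EFin \o (h \_ A)%R] = (\int[mu]_(x in A) (h x `^ r)%:E) `^ r^-1.
  move=> h0 r0.
  have E : \int[mu]_x (`|(EFin \o (h \_ A)%R) x| `^ r) = \int[mu]_(x in A) (h x `^ r)%:E.
    rewrite [RHS]integral_mkcond; apply: eq_integral => x _ /=.
    rewrite !patchE; case: ifPn => // _; first by rewrite ger0_norm.
    by rewrite normr0 powR0// gt_eqF.
  by rewrite Lnorm.unlock E.
rewrite !NE// Lnorm1; apply: le_trans.
rewrite integral_mkcond le_eqVlt; apply/orP; left; apply/eqP.
apply: eq_integral => x _ /=; rewrite !patchE; case: ifPn => // _.
  by rewrite ger0_norm// mulr_ge0.
by rewrite mul0r normr0.
Qed.

End HoelderOn.

(** * The conditional square function and the pairing *)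

Section PairingBound.
Context {R : realType} (P : probability (full_line R) R).
Implicit Types (n m i N : nat) (k j : int) (x y a : R) (f g : process R)
  (c d : nat -> int -> R) (b : int -> R).

Local Notation kn := dyadic_index.
Local Notation haar_var := (haar_var P).
Local Notation sqsum := (sqsum P).
Local Notation atom_power := (atom_power P).
Local Notation coef_norm := (coef_norm P).

Definition sqsum_trunc N c x : R :=
  \sum_(n < N) c n (kn n x) ^+ 2 * haar_var n (kn n x).

Lemma sqsum_trunc_ge0 N c x : 0 <= sqsum_trunc N c x.
Proof. by apply: sumr_ge0 => n _; exact: sqsum_term_ge0. Qed.

Lemma sqsum_trunc_measurable N c :
  measurable_fun setT (sqsum_trunc N c : full_line R -> R).
Proof. by apply: measurable_sum => n; exact: sqsum_term_measurable. Qed.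

Lemma sqsum_trunc_nd c x : {homo (fun N => sqsum_trunc N c x) : n m / (n <= m)%N >-> n <= m}.
Proof.
apply: homo_leq => //; first by move=> ? ? ?; exact: le_trans.
by move=> N; rewrite /sqsum_trunc big_ord_recr /= lerDl sqsum_term_ge0.
Qed.

Lemma sqsum_truncE N c x : (sqsum_trunc N c x)%:E =
  (\sum_(0 <= n < N) (c n (kn n x) ^+ 2 * haar_var n (kn n x))%:E)%E.
Proof. by rewrite big_mkord sumEFin. Qed.

Lemma sqsum_trunc_cvg c x : (sqsum_trunc N c x)%:E @[N --> \oo] --> sqsum c x.
Proof.
under eq_fun do rewrite sqsum_truncE.
by apply: is_cvg_nneseries => n _ _; rewrite lee_fin sqsum_term_ge0.
Qed.

Lemma sqsum_trunc_le N c x : ((sqsum_trunc N c x)%:E <= sqsum c x)%E.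
Proof.
rewrite sqsum_truncE; apply: nneseries_lim_ge => n _ _.
by rewrite lee_fin sqsum_term_ge0.
Qed.

Lemma measurable_unit_itv j : measurable (unit_itv j : set (full_line R)).
Proof. by rewrite unit_itvE; exact: dyadic_itv_measurable. Qed.

Lemma powR_sqrt (x p : R) : 0 <= x -> Num.sqrt x `^ p = x `^ (p / 2).
Proof. by move=> x0; rewrite -powR12_sqrt// -powRrM mulrC. Qed.

Lemma le0_poweR (x y : \bar R) (r : R) : 0 <= r -> (0 <= x -> x <= y -> x `^ r <= y `^ r)%E.
Proof.
move=> r0 x0 xy; apply: gt0_ler_poweR => //; rewrite in_itv /= ?x0 ?leey//.
by rewrite (le_trans x0 xy).
Qed.

Lemma atom_power_trunc p N c j : 0 < p ->
  (\int[P]_(x in unit_itv j) (sqsum_trunc N c x `^ (p / 2))%:E <= atom_power p c j)%E.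
Proof.
move=> p0; apply: ge0_le_integral.
- exact: measurable_unit_itv.
- by move=> x _; rewrite lee_fin powR_ge0.
- apply: measurable_funTS; apply/measurable_EFinP.
  by apply: (measurableT_comp (measurable_powR _)); exact: sqsum_trunc_measurable.
- by apply: measurable_funTS; exact: (measurableT_comp (measurable_poweR (p / 2)) (sqsum_measurable P c)).
move=> x _; rewrite -poweR_EFin; apply: le0_poweR.
- by rewrite divr_ge0// ltW.
- by rewrite lee_fin sqsum_trunc_ge0.
- exact: sqsum_trunc_le.
Qed.

Lemma atom_power_ge0 p c j : (0 <= atom_power p c j)%E.
Proof. by apply: integral_ge0 => x _; exact: poweR_ge0. Qed.

(** Cauchy-Schwarz in [n] at each point, with [haar_var] split into two square roots, followed by
    Hoelder in [x] on [unit_itv j]. Truncating at [N] keeps the integrands real; the bound does not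
    depend on [N]. *)
Lemma local_pairing_bound p r N c d j : 0 < p -> 0 < r -> p^-1 + r^-1 = 1 ->
  (\int[P]_(x in unit_itv j)
     (\sum_(n < N) `|c n (kn n x) * d n (kn n x)| * haar_var n (kn n x))%:E <=
   atom_power p c j `^ p^-1 * atom_power r d j `^ r^-1)%E.
Proof.
move=> p0 r0 pr.
have ms e : measurable_fun setT (fun x : full_line R => Num.sqrt (sqsum_trunc N e x)).
  rewrite [X in measurable_fun _ X](_ : _ = fun x => sqsum_trunc N e x `^ 2^-1); last first.
    by apply/funext => x; rewrite powR12_sqrt ?sqsum_trunc_ge0.
  by apply: (measurableT_comp (measurable_powR _)); exact: sqsum_trunc_measurable.
have := hoelder_on P (measurable_unit_itv j) (ms c) (ms d) (fun x => sqrtr_ge0 _)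
  (fun x => sqrtr_ge0 _) p0 r0 pr.
under [X in (_ <= X `^ _ * _)%E]eq_integral do rewrite powR_sqrt ?sqsum_trunc_ge0//.
under [X in (_ <= _ * X `^ _)%E]eq_integral do rewrite powR_sqrt ?sqsum_trunc_ge0//.
move=> H; apply: (@le_trans _ _ (\int[P]_(x in unit_itv j)
    (Num.sqrt (sqsum_trunc N c x) * Num.sqrt (sqsum_trunc N d x))%:E)%E).
  apply: ge0_le_integral.
  - exact: measurable_unit_itv.
  - by move=> x _; rewrite lee_fin sumr_ge0// => n _; rewrite mulr_ge0 ?haar_var_ge0.
  - apply: measurable_funTS; apply/measurable_EFinP; apply: measurable_sum => n.
    by apply: (@dyadic_fun_full_measurable _ _ _ n) => x y ->.
  - by apply: measurable_funTS; apply/measurable_EFinP; exact: measurable_funM.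
  move=> x _; rewrite lee_fin.
  have := cauchy_schwarz_seq (index_enum 'I_N)
    (fun n : 'I_N => c n (kn n x) * Num.sqrt (haar_var n (kn n x)))
    (fun n : 'I_N => d n (kn n x) * Num.sqrt (haar_var n (kn n x))).
  have sE (e : nat -> int -> R) : \sum_(n < N) (e n (kn n x) * Num.sqrt (haar_var n (kn n x))) ^+ 2 = sqsum_trunc N e x.
    by apply: eq_bigr => n _; rewrite exprMn sqr_sqrtr// haar_var_ge0.
  rewrite !sE; apply: le_trans; rewrite le_eqVlt; apply/orP; left; apply/eqP.
  apply: eq_bigr => n _; rewrite [in RHS]mulrACA [RHS]normrM -expr2 sqr_sqrtr ?haar_var_ge0//.
  by rewrite (ger0_norm (haar_var_ge0 P _ _)).
apply: (le_trans H); apply: lee_pmul; rewrite ?poweR_ge0//.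
  apply: le0_poweR; rewrite ?invr_ge0 ?(ltW p0) ?atom_power_trunc//.
  by apply: integral_ge0 => x _; rewrite lee_fin powR_ge0.
apply: le0_poweR; rewrite ?invr_ge0 ?(ltW r0) ?atom_power_trunc//.
by apply: integral_ge0 => x _; rewrite lee_fin powR_ge0.
Qed.

Lemma coef_norm_esum_lty p q c : 0 < q -> (coef_norm p q c < +oo)%E ->
  (\esum_(j in [set: int]) (atom_power p c j `^ (q / p)) < +oo)%E.
Proof. by move=> q0; apply: lty_poweRy; rewrite invr_neq0// gt_eqF. Qed.

Lemma atom_power_fin p q c j : 0 < p -> 0 < q -> (coef_norm p q c < +oo)%E ->
  atom_power p c j \is a fin_num.
Proof.
move=> p0 q0 /(coef_norm_esum_lty q0) h.
rewrite ge0_fin_numE ?atom_power_ge0//.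
apply: (@lty_poweRy _ _ (q / p)); first by rewrite gt_eqF// divr_gt0.
apply: le_lt_trans h.
have := @seq_le_esum R int (fun j => atom_power p c j `^ (q / p))%E [:: j] isT.
by rewrite big_seq1.
Qed.

(** All terms are nonnegative, so it suffices to bound partial sums in [n] over finitely many
    [unit_itv j]; there the local bound is summed by Hoelder with exponents [q] and [t]. *)
Lemma pairing_bound p q r t c d : 0 < p -> 0 < q -> 0 < r -> 0 < t ->
  p^-1 + r^-1 = 1 -> q^-1 + t^-1 = 1 ->
  (coef_norm p q c < +oo)%E -> (coef_norm r t d < +oo)%E ->
  (\sum_(n <oo) \int[P]_x (`|c n (kn n x) * d n (kn n x)| * haar_var n (kn n x))%:E <=
   coef_norm p q c * coef_norm r t d)%E.
Proof.
move=> p0 q0 r0 t0 pr qt cfin dfin.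
have t_ge0 n x : 0 <= `|c n (kn n x) * d n (kn n x)| * haar_var n (kn n x).
  by rewrite mulr_ge0 ?haar_var_ge0.
have mt n : measurable_fun setT (fun x : full_line R => `|c n (kn n x) * d n (kn n x)| * haar_var n (kn n x)).
  by apply: (@dyadic_fun_full_measurable _ _ _ n) => x y ->.
apply: lime_le.
  by apply: is_cvg_nneseries => n _ _; apply: integral_ge0 => x _; rewrite lee_fin.
apply: nearW => N; rewrite big_mkord -ge0_integral_sum//; last 2 first.
- by move=> n; exact/measurable_EFinP.
- by move=> n x _; rewrite lee_fin.
under eq_integral do rewrite sumEFin.
rewrite integral_unit_itv; last 2 first.
- by apply/measurable_EFinP; exact: measurable_sum.
- by move=> x; rewrite lee_fin sumr_ge0.
apply: esum_le_seq => s us.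
apply: (@le_trans _ _ (\sum_(j <- s) (atom_power p c j `^ p^-1 * atom_power r d j `^ r^-1))%E).
  by apply: lee_sum => j _; exact: local_pairing_bound.
pose u j := fine (atom_power p c j) `^ p^-1.
pose v j := fine (atom_power r d j) `^ r^-1.
rewrite (eq_bigr (fun j => (u j * v j)%:E)); last first.
  move=> j _; have cE := fineK (atom_power_fin j p0 q0 cfin).
  have dE := fineK (atom_power_fin j r0 t0 dfin).
  by rewrite -[in LHS]cE -[in LHS]dE.
rewrite sumEFin.
have := hoelder_seq s (fun j => powR_ge0 (fine (atom_power p c j)) p^-1)
  (fun j => powR_ge0 (fine (atom_power r d j)) r^-1) q0 t0 qt.
rewrite -lee_fin => /le_trans; apply.
have bnd p0' q0' e : 0 < p0' -> 0 < q0' -> (coef_norm p0' q0' e < +oo ->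
   ((\sum_(j <- s) (fine (atom_power p0' e j) `^ p0'^-1) `^ q0') `^ q0'^-1)%:E <= coef_norm p0' q0' e)%E.
  move=> p1 q1 efin; rewrite -poweR_EFin; apply: le0_poweR.
  - by rewrite invr_ge0 ltW.
  - by rewrite lee_fin sumr_ge0// => j _; exact: powR_ge0.
  rewrite -sumEFin; apply: le_trans (seq_le_esum _ us); apply: lee_sum => j _.
  rewrite -powRrM -poweR_EFin fineK; last exact: (atom_power_fin _ p1 q1).
  by rewrite mulrC.
rewrite EFinM; apply: lee_pmul; rewrite ?lee_fin ?powR_ge0//; exact: bnd.
Qed.

End PairingBound.

(** * Finite Haar sums *)

Section FiniteSpans.
Context {R : realType} (P : probability (full_line R) R).
Implicit Types (n m i N : nat) (k j : int) (x y a : R) (f g : process R)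
  (c d : nat -> int -> R) (b : int -> R) (F : seq int) (S : seq (nat * int)).

Local Notation kn := dyadic_index.
Local Notation pt := (@dyadic_point R).
Local Notation itv n k := (@dyadic_itv R n k : set (full_line R)).
Local Notation sqsum := (sqsum P).
Local Notation sqsum_trunc := (sqsum_trunc P).
Local Notation atom_power := (atom_power P).
Local Notation coef_norm := (coef_norm P).
Local Notation haar_process := (haar_process P).
Local Notation Hs := (Hs P).

(** The [j] for which [unit_itv j] contains [dyadic_itv n k]. *)
Definition dyadic_root n k : int := kn 0 (pt n k).

Lemma dyadic_root_index n x : dyadic_root n (kn n x) = kn 0 x.
Proof. by apply: (@dyadic_index_le _ n) => //; rewrite dyadic_pointK. Qed.

Lemma dyadic_root_left n k : dyadic_root n.+1 (2 * k) = dyadic_root n k.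
Proof.
by apply: (@dyadic_index_le _ n) => //; rewrite dyadic_index_left dyadic_pointK.
Qed.

Lemma dyadic_root_right n k : dyadic_root n.+1 (2 * k + 1) = dyadic_root n k.
Proof.
by apply: (@dyadic_index_le _ n) => //; rewrite dyadic_index_right dyadic_pointK.
Qed.

Fixpoint dyadic_keys F n : seq int :=
  if n is m.+1 then [seq 2 * k | k <- dyadic_keys F m] ++ [seq 2 * k + 1 | k <- dyadic_keys F m]
  else F.

Lemma mem_dyadic_keys F n k : (k \in dyadic_keys F n) = (dyadic_root n k \in F).
Proof.
elim: n k => [|n IH] k /=; first by rewrite /dyadic_root dyadic_pointK.
set h := kn n (pt n.+1 k).
have hE : k = 2 * h \/ k = 2 * h + 1.
  by have := dyadic_indexS n (pt n.+1 k); rewrite dyadic_pointK.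
rewrite mem_cat; case: hE => kE; rewrite kE.
  rewrite dyadic_root_left -IH; apply/orP/idP => [[/mapP[k' k'F hk]|/mapP[k' _ hk]]|hF].
  - by have -> : h = k' by lia.
  - by lia.
  - by left; apply: map_f.
rewrite dyadic_root_right -IH; apply/orP/idP => [[/mapP[k' _ hk]|/mapP[k' k'F hk]]|hF].
- by lia.
- by have -> : h = k' by lia.
- by right; apply/mapP; exists h.
Qed.

Lemma dyadic_keys_uniq F n : uniq F -> uniq (dyadic_keys F n).
Proof.
move=> uF; elim: n => //= n IH; rewrite cat_uniq !map_inj_uniq ?IH; last 2 first.
- by move=> k k'; lia.
- by move=> k k'; lia.
rewrite andbT /=; apply/hasPn => _ /mapP[k _ ->]; apply/negP => /mapP[k' _]; lia.
Qed.

Lemma sum_dyadic_keys F n (h : full_line R -> \bar R) :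
  measurable_fun setT h ->
  (\sum_(k <- dyadic_keys F n) \int[P]_(x in itv n k) h x =
   \sum_(j <- F) \int[P]_(x in unit_itv j) h x)%E.
Proof.
move=> mh; elim: n => [|n IH] /=; first by apply: eq_bigr => j _; rewrite unit_itvE.
rewrite -IH big_cat /= !big_map -big_split /=; apply: eq_bigr => k _.
by rewrite [RHS]integral_dyadic_itvS.
Qed.

Definition key_pairs F N : seq (nat * int) :=
  [seq (n, k) | n <- iota 0 N, k <- dyadic_keys F n].

Lemma mem_key_pairs F N n k :
  ((n, k) \in key_pairs F N) = (n < N)%N && (dyadic_root n k \in F).
Proof.
rewrite -mem_dyadic_keys; apply/allpairsPdep/andP => [[n' [k' [n'N k'F [-> ->]]]]|[nN kF]].
  by rewrite k'F; move: n'N; rewrite mem_iota.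
by exists n, k; rewrite mem_iota.
Qed.

Lemma key_pairs_uniq F N : uniq F -> uniq (key_pairs F N).
Proof.
move=> uF; apply: allpairs_uniq_dep => //; first exact: iota_uniq.
  by move=> n _; exact: dyadic_keys_uniq.
by move=> [n k] [n' k'] _ _ /= [-> ->].
Qed.

Definition restrict S c n k : R := if (n, k) \in S then c n k else 0.

Definition delta_coef (s : nat * int) n k : R := ((n, k) == s)%:R.

Lemma restrict_cons s S c : s \notin S ->
  restrict (s :: S) c = fun n k => c s.1 s.2 * delta_coef s n k + restrict S c n k.
Proof.
move=> sS; apply/funext => n; apply/funext => k; rewrite /restrict /delta_coef inE.
have [sE|_] /= := eqVneq (n, k) s; last by rewrite mulr0 add0r.
by move: sS; rewrite -sE => /negbTE -> /=; rewrite mulr1 addr0.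
Qed.

Lemma haar_process_lin a c d : haar_process (fun n k => a * c n k + d n k) =
  fun n x => a * haar_process c n x + haar_process d n x.
Proof.
apply/funext => n; apply/funext => x; rewrite /haar_process mulr_sumr -big_split /=.
by apply: eq_bigr => i _; rewrite mulrDl mulrA.
Qed.

Lemma restrict_nil c : restrict [::] c = fun _ _ => 0.
Proof. by []. Qed.

Lemma haar_process0 : haar_process (fun _ _ => 0) = fun _ _ => 0.
Proof.
apply/funext => n; apply/funext => x; rewrite /haar_process big1// => i _.
by rewrite mul0r.
Qed.

Lemma esum_finite_support (J : seq int) (e : int -> \bar R) : uniq J ->
  (forall j, 0 <= e j)%E -> (forall j, j \notin J -> e j = 0%E) ->
  (\esum_(j in [set: int]) e j = \sum_(j <- J) e j)%E.
Proof.
move=> uJ e0 eJ.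
have -> : (\esum_(j in [set: int]) e j = \esum_(j in [set` J]) e j)%E.
  rewrite [RHS]esum_mkcond; apply: eq_esum => j _.
  by rewrite mem_setE; case: ifPn => // /eJ.
have fJ : finite_set [set` J] by exact: finite_seq.
by rewrite esum_fset// [RHS]fsbig_seq.
Qed.

Lemma sqsum_restrict0 S c x : kn 0 x \notin [seq dyadic_root s.1 s.2 | s <- S] ->
  sqsum (restrict S c) x = 0%E.
Proof.
move=> xS; apply: eseries0 => n _ _; rewrite /restrict; case: ifP => [nS|_].
  case/negP: xS; apply/mapP; exists (n, kn n x) => //=.
  by rewrite dyadic_root_index.
by rewrite expr0n mul0r.
Qed.

Lemma sqsum_restrictE S c x N : (forall s, s \in S -> (s.1 < N)%N) ->
  sqsum (restrict S c) x = (sqsum_trunc N (restrict S c) x)%:E.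
Proof.
move=> SN; rewrite /sqsum (@nneseries_split _ _ 0 N); last first.
  by move=> n _; rewrite lee_fin sqsum_term_ge0.
rewrite add0n [X in (_ + X)%E]eseries0 ?adde0 ?sqsum_truncE// => n Nn _.
rewrite /restrict; case: ifP => [/SN/=|_]; first by rewrite ltnNge Nn.
by rewrite expr0n mul0r.
Qed.

Lemma sqsum_truncS_cst N c x y : kn N x = kn N y ->
  sqsum_trunc N.+1 c x = sqsum_trunc N.+1 c y.
Proof.
move=> xy; apply: eq_bigr => n _.
by rewrite (dyadic_index_le (leq_ord n) xy).
Qed.

Lemma sqsum_trunc_cst N c x y : kn N x = kn N y -> sqsum_trunc N c x = sqsum_trunc N c y.
Proof.
case: N => [|N xy]; first by rewrite /sqsum_trunc !big_ord0.
exact: (sqsum_truncS_cst c (dyadic_indexS_half xy)).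
Qed.

(** Only finitely many [unit_itv j] contribute, and on each the square function is a finite sum,
    constant on the intervals of some level [N]. *)
Lemma coef_norm_restrict p q S c : 0 < p -> 0 < q ->
  (coef_norm p q (restrict S c) < +oo)%E.
Proof.
move=> p0 q0; apply: poweR_lty.
rewrite (@esum_finite_support (undup [seq dyadic_root s.1 s.2 | s <- S])); last 3 first.
- exact: undup_uniq.
- by move=> j; exact: poweR_ge0.
- move=> j; rewrite mem_undup => jS; rewrite /atom_power integral0_eq ?poweR0r//.
    by rewrite gt_eqF// divr_gt0.
  move=> x; rewrite unit_itvE dyadic_itvE /= => xj.
  by rewrite sqsum_restrict0 ?xj// poweR0r// gt_eqF// divr_gt0.
apply: lte_sum_pinfty => j _; apply: poweR_lty.
pose N := (\max_(s <- S) s.1.+1)%N.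
have SN s : s \in S -> (s.1 < N)%N by move=> sS; exact: (@leq_bigmax_seq _ S xpredT (fun s => s.1.+1) s sS isT).
rewrite /atom_power; under eq_integral do rewrite (sqsum_restrictE _ _ SN) poweR_EFin.
have : P.-integrable (unit_itv j)
    (EFin \o (fun x : full_line R => sqsum_trunc N (restrict S c) x `^ (p / 2))).
  rewrite unit_itvE; apply: (@dyadic_fun_integrable _ P N) => x y xy.
  by rewrite (sqsum_trunc_cst _ xy).
case/integrableP => _; apply: le_lt_trans; apply: ge0_le_integral => //.
- exact: measurable_unit_itv.
- by move=> x _; rewrite lee_fin powR_ge0.
- apply: measurable_funTS; apply/measurable_EFinP.
  by apply: (measurableT_comp (measurable_powR _)); exact: sqsum_trunc_measurable.
- apply: measurableT_comp => //; apply: measurable_funTS; apply/measurable_EFinP.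
  by apply: (measurableT_comp (measurable_powR _)); exact: sqsum_trunc_measurable.
by move=> x _; rewrite lee_abs.
Qed.

Lemma HsP p q f c : represents P f c ->
  Hs p q f <-> tree_martingale P f /\ (coef_norm p q c < +oo)%E.
Proof.
move=> fc; rewrite /Hs /=; split => -[tf].
  by move: (tf) => /tree_martingaleP{}tf; rewrite (Hs_normE _ _ tf fc).
by rewrite (tree_martingaleP P f) -(Hs_normE p q tf fc).
Qed.

Lemma Hs_haar p q c : (coef_norm p q c < +oo)%E -> Hs p q (haar_process c).
Proof.
move=> cfin; apply/(HsP p q (@represents_haar R P c)); split => //.
exact: tree_martingale_haar.
Qed.

Lemma Hs0 p q : 0 < p -> 0 < q -> Hs p q (fun _ _ => 0).
Proof.
move=> p0 q0; rewrite -haar_process0 -(restrict_nil (fun _ _ => 0)).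
by apply: Hs_haar; exact: coef_norm_restrict.
Qed.

Lemma Hs_dual0 p q L : Hs_dual P p q L -> 0 < p -> 0 < q -> L (fun _ _ => 0) = 0.
Proof.
move=> [Llin _] p0 q0.
have H0 := Hs0 p0 q0.
have := Llin 1 _ _ H0 H0.
have -> : (fun n x => 1 * 0 + 0) = (fun _ _ => 0) :> process R.
  by apply/funext => n; apply/funext => x; rewrite mulr0 addr0.
by rewrite mul1r => /eqP; rewrite -subr_eq0 opprD addrA subrr sub0r oppr_eq0 => /eqP.
Qed.

Lemma delta_coef_restrict s : delta_coef s = restrict [:: s] (fun _ _ => 1).
Proof.
apply/funext => n; apply/funext => k; rewrite /restrict inE /delta_coef.
by case: eqP.
Qed.

Lemma Hs_delta p q s : 0 < p -> 0 < q -> Hs p q (haar_process (delta_coef s)).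
Proof. by move=> p0 q0; apply: Hs_haar; rewrite delta_coef_restrict; exact: coef_norm_restrict. Qed.

Lemma Hs_dual_restrict p q L S c : Hs_dual P p q L -> 0 < p -> 0 < q -> uniq S ->
  L (haar_process (restrict S c)) = \sum_(s <- S) c s.1 s.2 * L (haar_process (delta_coef s)).
Proof.
move=> LD p0 q0; have [Llin _] := LD; elim: S => [_|s S IH /= /andP[sS uS]].
  by rewrite big_nil restrict_nil haar_process0 (Hs_dual0 LD).
rewrite big_cons -IH// restrict_cons// haar_process_lin Llin//.
  exact: Hs_delta.
by apply: Hs_haar; exact: coef_norm_restrict.
Qed.

End FiniteSpans.

(** * Extremal martingales *)

Section LowerBound.
Context {R : realType} (P : probability (full_line R) R).
Implicit Types (n m i N : nat) (k j : int) (x y a : R) (f g : process R)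
  (c d : nat -> int -> R) (b : int -> R) (F : seq int) (S : seq (nat * int)).

Local Notation kn := dyadic_index.
Local Notation pt := (@dyadic_point R).
Local Notation mass := (mass P).
Local Notation root := (@dyadic_root R).
Local Notation haar_var := (haar_var P).
Local Notation sqsum := (sqsum P).
Local Notation sqsum_trunc := (sqsum_trunc P).
Local Notation atom_power := (atom_power P).
Local Notation coef_norm := (coef_norm P).
Local Notation key_pairs := (@key_pairs).

(** The quantity [N_j ^ r] of the overview, whence the exponents [t / r] and [t / r - 1] below. The
    truncation makes it finite for every [c]. *)
Definition trunc_power r N c j : R :=
  fine (\int[P]_(x in unit_itv j) (sqsum_trunc N c x `^ (r / 2))%:E).

Lemma trunc_powerE r N c j :
  (trunc_power r N c j)%:E = (\int[P]_(x in unit_itv j) (sqsum_trunc N c x `^ (r / 2))%:E)%E.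
Proof.
rewrite /trunc_power fineK//; apply: integrable_fin_num => //; first exact: measurable_unit_itv.
rewrite unit_itvE; apply: (@dyadic_fun_integrable _ P N _ _ (fun x => sqsum_trunc N c x `^ (r / 2))) => x y xy.
by rewrite (sqsum_trunc_cst P c xy).
Qed.

Lemma trunc_power_ge0 r N c j : 0 <= trunc_power r N c j.
Proof. by apply: fine_ge0; apply: integral_ge0 => x _; rewrite lee_fin powR_ge0. Qed.

Lemma measurable_trunc_power (r : R) N c :
  measurable_fun setT (fun x : full_line R => (sqsum_trunc N c x `^ r)%:E).
Proof.
apply/measurable_EFinP.
by apply: (measurableT_comp (measurable_powR _)); exact: sqsum_trunc_measurable.
Qed.

(* The martingale transform of [c] by the predictable weights
   [s_n ^ (r - 2)], where [s_n] is the square root of the partial sums of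
   the conditional square function; the factor depending on the root
   interval accounts for the outer [l_t] norm. *)
Definition extremal_weight (r t a : R) N c n k : R :=
  a * trunc_power r N c (root n k) `^ (t / r - 1) *
  sqsum_trunc n.+1 c (pt n k) `^ (r / 2 - 1).

Lemma extremal_weightE r t a N c n x :
  extremal_weight r t a N c n (kn n x) =
  a * trunc_power r N c (kn 0 x) `^ (t / r - 1) * sqsum_trunc n.+1 c x `^ (r / 2 - 1).
Proof.
rewrite /extremal_weight dyadic_root_index (@sqsum_truncS_cst _ P n c (pt n (kn n x)) x)//.
by rewrite dyadic_pointK.
Qed.

(** Squaring the weight [T ^ (r / 2 - 1)] gives [T ^ (r - 2)], whose sum against the increments of
    [T] is the case [b = r - 1] of [powR_increment_sum]; [C] is the constant found there. *)
Lemma sqsum_extremal r t a N c F C :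
  (forall (u : nat -> R) N, (forall n, 0 <= u n) ->
    \sum_(n < N) (\sum_(i < n.+1) u i) `^ (r - 1 - 1) * u n <=
    C * (\sum_(i < N) u i) `^ (r - 1)) ->
  forall x, kn 0 x \in F ->
  (sqsum (restrict (key_pairs F N)
     (fun n k => (extremal_weight r t a N c n k * c n k)%R)) x <=
  ((a * trunc_power r N c (kn 0 x) `^ (t / r - 1)) ^+ 2 *
    (C * sqsum_trunc N c x `^ (r - 1)))%:E)%E.
Proof.
move=> HC x xF; rewrite (@sqsum_restrictE _ P _ _ _ N); last first.
  by move=> [n k]; rewrite (@mem_key_pairs R) => /andP[].
have := HC (fun n => c n (kn n x) ^+ 2 * haar_var n (kn n x)) N
  (fun n => sqsum_term_ge0 P c n x).
rewrite lee_fin => h.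
apply: (le_trans _ (ler_wpM2l (sqr_ge0 _) h)).
rewrite mulr_sumr; apply: ler_sum => n _.
rewrite /restrict (@mem_key_pairs R) ltn_ord dyadic_root_index xF/=.
rewrite extremal_weightE -/(sqsum_trunc n.+1 c x).
set A := a * _; set T := sqsum_trunc n.+1 c x.
rewrite [leLHS](_ : _ = A ^+ 2 *
    ((T `^ (r / 2 - 1)) ^+ 2 * (c n (kn n x) ^+ 2 * haar_var n (kn n x)))); last by ring.
have -> : (T `^ (r / 2 - 1)) ^+ 2 = T `^ (r - 1 - 1).
  by rewrite -powR_mulrn ?powR_ge0// -powRrM; congr (_ `^ _); field.
by [].
Qed.

(** The exponents match by conjugacy: [p * (r - 1) = r] turns the power [p / 2] of [T ^ (r - 1)]
    into [T ^ (r / 2)], which integrates to [trunc_power]; then [q * (t - 1) = t] gives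
    [(t / r - 1) * q + q / p = t / r]. *)
Lemma extremal_upper p q r t a N c F C : 0 < p -> 0 < q -> 0 < r -> 0 < t -> 0 < C ->
  p^-1 + r^-1 = 1 -> q^-1 + t^-1 = 1 -> 0 <= a -> uniq F ->
  (forall (u : nat -> R) N, (forall n, 0 <= u n) ->
    \sum_(n < N) (\sum_(i < n.+1) u i) `^ (r - 1 - 1) * u n <=
    C * (\sum_(i < N) u i) `^ (r - 1)) ->
  (coef_norm p q (restrict (key_pairs F N)
     (fun n k => (extremal_weight r t a N c n k * c n k)%R)) <=
  (a * C `^ 2^-1 * (\sum_(j <- F) trunc_power r N c j `^ (t / r)) `^ q^-1)%:E)%E.
Proof.
move=> p0 q0 r0 t0 C0 pr qt a0 uF HC.
set d := restrict _ _.
have pE : p * (r - 1) = r.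
  have : p * r * (p^-1 + r^-1) = p * r by rewrite pr mulr1.
  have -> : p * r * (p^-1 + r^-1) = r + p by field; rewrite !gt_eqF.
  by move=> h; lra.
have qE : q * (t - 1) = t.
  have : q * t * (q^-1 + t^-1) = q * t by rewrite qt mulr1.
  have -> : q * t * (q^-1 + t^-1) = t + q by field; rewrite !gt_eqF.
  by move=> h; lra.
have qp0 : q / p != 0 by rewrite gt_eqF// divr_gt0.
have G0 j := trunc_power_ge0 r N c j.
have apF j : j \in F -> (atom_power p d j `^ (q / p) <=
    (a `^ q * C `^ (q / 2) * trunc_power r N c j `^ (t / r))%:E)%E.
  move=> jF; set G := trunc_power r N c j; set w := a * G `^ (t / r - 1).
  have w0 : 0 <= w by rewrite mulr_ge0 ?powR_ge0.
  have ub : (atom_power p d j <= (w `^ p * C `^ (p / 2) * G)%:E)%E.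
    rewrite EFinM /G trunc_powerE -ge0_integralZl_EFin//; last 4 first.
    - exact: measurable_unit_itv.
    - by move=> x _; rewrite lee_fin powR_ge0.
    - by apply: measurable_funTS; exact: measurable_trunc_power.
    - by rewrite mulr_ge0 ?powR_ge0.
    apply: ge0_le_integral.
    - exact: measurable_unit_itv.
    - by move=> x _; exact: poweR_ge0.
    - by apply: measurable_funTS; exact: (measurableT_comp (measurable_poweR (p / 2)) (sqsum_measurable P d)).
    - apply: measurable_funTS; apply: measurable_funeM; exact: measurable_trunc_power.
    move=> x; rewrite unit_itvE dyadic_itvE /= => xj.
    have xF : kn 0 x \in F by rewrite xj.
    have h := @sqsum_extremal r t a N c F C HC x xF.
    have p2 : 0 <= p / 2 by rewrite divr_ge0 ?ltW.
    apply: (le_trans (le0_poweR p2 (sqsum_ge0 P d x) h)).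
    rewrite xj -/G -/w poweR_EFin -EFinM lee_fin.
    rewrite powRM ?sqr_ge0 ?mulr_ge0 ?powR_ge0 ?(ltW C0)//.
    rewrite powRM ?powR_ge0 ?(ltW C0)// -powR_mulrn// -!powRrM.
    have -> : 2%:R * (p / 2) = p by field.
    have -> : (r - 1) * (p / 2) = r / 2 by rewrite mulrA (mulrC _ p) pE.
    by rewrite mulrA.
  have qp : 0 <= q / p by rewrite divr_ge0 ?ltW.
  apply: (le_trans (le0_poweR qp (atom_power_ge0 P p d j) ub)).
  rewrite poweR_EFin lee_fin.
  have G0j : 0 <= G by exact: G0.
  rewrite powRM ?mulr_ge0 ?powR_ge0// powRM ?powR_ge0// -!powRrM.
  have -> : p * (q / p) = q by field; rewrite gt_eqF.
  have -> : p / 2 * (q / p) = q / 2 by field; rewrite gt_eqF.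
  rewrite /w powRM ?powR_ge0// -powRrM.
  rewrite le_eqVlt; apply/orP; left; apply/eqP.
  rewrite [LHS](_ : _ = a `^ q * C `^ (q / 2) * (G `^ ((t / r - 1) * q) * G `^ (q / p))); last by ring.
  (* Exponents of different signs can be added only over a nonzero base; at [G = 0] both sides
     vanish because [q / p] and [t / r] are nonzero. *)
  congr (_ * _); have [->|Gn0] := eqVneq G 0.
    by rewrite [0 `^ (q / p)]powR0// mulr0 powR0// gt_eqF// divr_gt0.
  rewrite -powRD; last by rewrite Gn0 implybT.
  congr (_ `^ _).
  have -> : p^-1 = 1 - r^-1 by rewrite -pr addrK.
  by rewrite -[in RHS]qE; field; rewrite gt_eqF.
rewrite [leRHS](_ : _ =
    ((\sum_(j <- F) (a `^ q * C `^ (q / 2) * trunc_power r N c j `^ (t / r))%:E) `^ q^-1)%E); last first.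
  rewrite sumEFin poweR_EFin -mulr_sumr powRM ?mulr_ge0 ?powR_ge0//; last first.
    by apply: sumr_ge0 => j _; exact: powR_ge0.
  rewrite powRM ?powR_ge0// -!powRrM divff ?gt_eqF// powRr1//.
  by have -> : q / 2 / q = 2^-1 by field; rewrite gt_eqF.
apply: le0_poweR; first by rewrite invr_ge0 ltW.
  by apply: esum_ge0 => j _; exact: poweR_ge0.
rewrite (@esum_finite_support _ F)//; last 2 first.
- by move=> j; exact: poweR_ge0.
- move=> j jF; rewrite /atom_power integral0_eq ?poweR0r// => x.
  rewrite unit_itvE dyadic_itvE /= => xj.
  rewrite /sqsum eseries0 ?poweR0r//; first by rewrite gt_eqF// divr_gt0.
  move=> n _ _; rewrite /d /restrict (@mem_key_pairs R) dyadic_root_index xj (negbTE jF) andbF.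
  by rewrite expr0n mul0r.
rewrite big_seq [X in (_ <= X)%E]big_seq; apply: lee_sum => j jF; exact: apF.
Qed.

(** The right-hand side is what a functional with coefficients [c] takes on the test martingale.
    Regrouped over [F] it is a sum of integrals of [T ^ (r / 2 - 1)] against the increments of [T],
    and the case [b = r / 2] bounds it below through [T ^ (r / 2)]. *)
Lemma extremal_lower r t a N c F (e : R) : 0 < r -> 0 < t -> 0 <= a -> 0 < e ->
  (forall (u : nat -> R) N, (forall n, 0 <= u n) ->
    e * (\sum_(i < N) u i) `^ (r / 2) <=
    \sum_(n < N) (\sum_(i < n.+1) u i) `^ (r / 2 - 1) * u n) ->
  a * e * (\sum_(j <- F) trunc_power r N c j `^ (t / r)) <=
  \sum_(s <- key_pairs F N) extremal_weight r t a N c s.1 s.2 *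
    (c s.1 s.2 ^+ 2 * haar_var s.1 s.2) * mass s.1 s.2.
Proof.
move=> r0 t0 a0 e0 He.
pose b n k := extremal_weight r t a N c n k * (c n k ^+ 2 * haar_var n k).
have b0 n k : 0 <= b n k.
  apply: mulr_ge0; last by rewrite mulr_ge0 ?sqr_ge0 ?haar_var_ge0.
  by rewrite mulr_ge0 ?powR_ge0// mulr_ge0 ?powR_ge0.
have mb n : measurable_fun setT (fun x : full_line R => (b n (kn n x))%:E).
  by apply: (@dyadic_fun_full_measurable _ _ _ n) => x y ->.
rewrite -lee_fin /key_pairs big_allpairs_dep /=.
rewrite (_ : (\sum_(n <- iota 0 N) _)%:E =
    (\sum_(j <- F) \int[P]_(x in unit_itv j) (\sum_(n <- iota 0 N) b n (kn n x))%:E)%E); last first.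
  rewrite -sumEFin.
  rewrite [RHS](eq_bigr (fun j => \sum_(n <- iota 0 N) \int[P]_(x in unit_itv j) (b n (kn n x))%:E)%E); last first.
    move=> j _; rewrite -ge0_integral_sum//.
    - by apply: eq_integral => x _; rewrite sumEFin.
    - exact: measurable_unit_itv.
    - by move=> n; apply: measurable_funTS; exact: mb.
    - by move=> n x _; rewrite lee_fin.
  rewrite exchange_big /=; apply: eq_bigr => n _.
  rewrite -(@sum_dyadic_keys _ P F n (fun x : full_line R => (b n (kn n x))%:E) (mb n)).
  rewrite -sumEFin; apply: eq_bigr => k _.
  rewrite (@integral_dyadic_itv_cst _ _ _ _ _ (b n k)%:E) -?EFinM//.
  by move=> x ->.
rewrite mulr_sumr -sumEFin; apply: lee_sum => j _.
set G := trunc_power r N c j.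
have -> : a * e * G `^ (t / r) = a * G `^ (t / r - 1) * e * G.
  have [->|Gn0] := eqVneq G 0.
    by rewrite mulr0 powR0 ?mulr0// gt_eqF// divr_gt0.
  have -> : G `^ (t / r) = G * G `^ (t / r - 1).
    by rewrite mulr_powRB1 ?divr_gt0//; exact: trunc_power_ge0.
  ring.
have ae0 : 0 <= a * G `^ (t / r - 1) * e by rewrite !mulr_ge0 ?powR_ge0// ltW.
rewrite EFinM {2}/G trunc_powerE -ge0_integralZl_EFin//; last 3 first.
- exact: measurable_unit_itv.
- by move=> x _; rewrite lee_fin powR_ge0.
- by apply: measurable_funTS; exact: measurable_trunc_power.
apply: ge0_le_integral.
- exact: measurable_unit_itv.
- by move=> x _; rewrite mule_ge0// lee_fin powR_ge0.
- by apply: measurable_funTS; apply: measurable_funeM; exact: measurable_trunc_power.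
- apply: measurable_funTS; apply/measurable_EFinP; apply: measurable_sum => n.
  by apply/measurable_EFinP; exact: mb.
move=> x; rewrite unit_itvE dyadic_itvE /= => xj.
rewrite -EFinM lee_fin -[leLHS]mulrA.
have := He (fun n => c n (kn n x) ^+ 2 * haar_var n (kn n x)) N
  (fun n => sqsum_term_ge0 P c n x).
have aG0 : 0 <= a * G `^ (t / r - 1) by rewrite mulr_ge0 ?powR_ge0.
move=> h; apply: (le_trans (ler_wpM2l aG0 h)).
have -> : iota 0 N = index_iota 0 N by rewrite /index_iota subn0.
rewrite big_mkord mulr_sumr; apply: ler_sum => n _.
by rewrite /b extremal_weightE xj -/G [leLHS]mulrA.
Qed.

End LowerBound.

(** * The norm of a functional controls its coefficients *)

Section DualBound.
Context {R : realType} (P : probability (full_line R) R).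
Implicit Types (n m i N : nat) (k j : int) (x y a : R) (f g : process R)
  (c d : nat -> int -> R) (b : int -> R) (F : seq int) (S : seq (nat * int)).

Local Notation mass := (mass P).
Local Notation haar_var := (haar_var P).
Local Notation sqsum := (sqsum P).
Local Notation sqsum_trunc := (sqsum_trunc P).
Local Notation atom_power := (atom_power P).
Local Notation coef_norm := (coef_norm P).
Local Notation haar_process := (haar_process P).
Local Notation trunc_power := (trunc_power P).

Lemma trunc_power_cvg r c j : 0 < r ->
  (trunc_power r N c j)%:E @[N --> \oo] --> atom_power r c j.
Proof.
move=> r0; have r2 : 0 < r / 2 by rewrite divr_gt0.
have nd x : nondecreasing_seq (fun N => (sqsum_trunc N c x)%:E).
  by move=> m n mn; rewrite lee_fin; exact: sqsum_trunc_nd.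
have cv x : (sqsum_trunc N c x `^ (r / 2))%:E @[N --> \oo] --> (sqsum c x `^ (r / 2))%E.
  have := nondecreasing_poweR_cvg r2 _ (nd x) (@sqsum_trunc_cvg R P c x).
  by apply => N; rewrite lee_fin sqsum_trunc_ge0.
rewrite (_ : (fun N => _) = (fun N => \int[P]_(x in unit_itv j) (sqsum_trunc N c x `^ (r / 2))%:E)%E); last first.
  by apply/funext => N; rewrite trunc_powerE.
rewrite (_ : atom_power r c j =
    (\int[P]_(x in unit_itv j) limn (fun N => (sqsum_trunc N c x `^ (r / 2))%:E))%E); last first.
  by apply: eq_integral => x _; rewrite (cvg_lim _ (cv x)).
apply: cvg_monotone_convergence.
- exact: measurable_unit_itv.
- by move=> N; apply: measurable_funTS; exact: measurable_trunc_power.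
- by move=> N x _; rewrite lee_fin powR_ge0.
- move=> x _ m n mn; rewrite lee_fin; apply: ge0_ler_powR; rewrite ?nnegrE ?sqsum_trunc_ge0 ?(ltW r2)//.
  exact: sqsum_trunc_nd.
Qed.

(** Finiteness of the norm is part of the conclusion: bounds uniform in the truncation pass to the
    limit by monotone convergence in [N] and a supremum over finite [F]. *)
Lemma coef_norm_le_trunc r t c (B : R) : 0 < r -> 0 < t -> 0 <= B ->
  (forall F N, uniq F -> \sum_(j <- F) trunc_power r N c j `^ (t / r) <= B `^ t) ->
  (coef_norm r t c <= B%:E)%E.
Proof.
move=> r0 t0 B0 H.
have tr : 0 < t / r by rewrite divr_gt0.
suff : (\esum_(j in [set: int]) (atom_power r c j `^ (t / r)) <= (B `^ t)%:E)%E.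
  move=> h; have ti : 0 <= t^-1 by rewrite invr_ge0 ltW.
  have := le0_poweR ti _ h; rewrite poweR_EFin -powRrM divff ?gt_eqF// powRr1//.
  by apply; apply: esum_ge0 => j _; exact: poweR_ge0.
apply: esum_le_seq => F uF.
have cv : (fun N => \sum_(j <- F) (trunc_power r N c j `^ (t / r))%:E)%E @ \oo -->
    (\sum_(j <- F) (atom_power r c j `^ (t / r)))%E.
  apply: (@cvg_nnesum _ _ _ _ _ F (fun j N => (trunc_power r N c j `^ (t / r))%:E) _ xpredT).
    by move=> j _; apply: nearW => N; rewrite lee_fin powR_ge0.
  move=> j _; apply: (nondecreasing_poweR_cvg tr _ _ (@trunc_power_cvg r c j r0)).
    by move=> N; rewrite lee_fin trunc_power_ge0.
  move=> m n mn; rewrite !trunc_powerE; apply: ge0_le_integral.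
  - exact: measurable_unit_itv.
  - by move=> x _; rewrite lee_fin powR_ge0.
  - by apply: measurable_funTS; exact: measurable_trunc_power.
  - by apply: measurable_funTS; exact: measurable_trunc_power.
  move=> x _; rewrite lee_fin; apply: ge0_ler_powR; rewrite ?nnegrE ?sqsum_trunc_ge0 ?divr_ge0 ?(ltW r0)//.
  exact: sqsum_trunc_nd.
rewrite -(cvg_lim _ cv)//; apply: lime_le; first by apply/cvg_ex; exists (\sum_(j <- F) (atom_power r c j `^ (t / r)))%E.
by apply: nearW => N; rewrite sumEFin lee_fin; exact: H.
Qed.

(** [D] is chosen before [L], [c] and [K], so the same constant serves to place the coefficients of
    a functional in the dual Hardy space and to bound the norm of a pairing from below. *)
Lemma dual_bound p q r t : 1 < p -> 1 < q -> 1 < r -> 1 < t ->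
  p^-1 + r^-1 = 1 -> q^-1 + t^-1 = 1 ->
  exists2 D : R, 0 < D & forall (L : process R -> R) c (K : R),
    Hs_dual P p q L ->
    (forall n k, L (haar_process (delta_coef (n, k))) = c n k * haar_var n k * mass n k) ->
    0 <= K -> (forall f, Hs P p q f -> (Hs_norm P p q f <= 1)%E -> `|L f| <= K) ->
    (coef_norm r t c <= (D * K)%:E)%E.
Proof.
move=> p1 q1 r1 t1 pr qt.
have [p0 q0 r0 t0] : [/\ 0 < p, 0 < q, 0 < r & 0 < t].
  by split; apply: lt_trans (ltr01) _.
have [e [Ce [e0 _ He]]] := @powR_increment_sum R (r / 2) (divr_gt0 r0 (ltr0Sn _ _)).
have [ce [C [_ C0 HC]]] := @powR_increment_sum R (r - 1) (etrans (subr_gt0 _ _) r1).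
exists (C `^ 2^-1 / e); first by rewrite divr_gt0 ?powR_gt0.
move=> L c K LD Lc K0 LK; apply: coef_norm_le_trunc => //.
  by rewrite mulr_ge0// divr_ge0 ?powR_ge0 ?ltW.
move=> F N uF; set M := \sum_(j <- F) _.
have M0 : 0 <= M by apply: sumr_ge0 => j _; exact: powR_ge0.
have [->|Mn0] := eqVneq M 0; first exact: powR_ge0.
have Mp : 0 < M by rewrite lt_neqAle eq_sym Mn0.
(* Chosen so that the bound of [extremal_upper] equals 1; this is where [M != 0] matters. *)
pose a := (C `^ 2^-1 * M `^ q^-1)^-1.
have a0 : 0 < a by rewrite invr_gt0 mulr_gt0 ?powR_gt0.
pose S := key_pairs F N.
pose d n k := extremal_weight P r t a N c n k * c n k.
have dnorm : (coef_norm p q (restrict S d) <= 1)%E.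
  have := @extremal_upper R P p q r t a N c F C p0 q0 r0 t0 C0 pr qt (ltW a0) uF
    (fun u N u0 => (HC u N u0).2).
  by rewrite -/M -mulrA mulVf// mulf_neq0// gt_eqF// powR_gt0.
have fH : Hs P p q (haar_process (restrict S d)).
  by apply: Hs_haar; exact: le_lt_trans dnorm (ltry _).
have : `|L (haar_process (restrict S d))| <= K.
  apply: LK => //.
  by rewrite (Hs_normE p q (tree_martingale_haar P _) (@represents_haar R P _)).
rewrite (Hs_dual_restrict d LD p0 q0 (key_pairs_uniq N uF)).
have := @extremal_lower R P r t a N c F e r0 t0 (ltW a0) e0 (fun u N u0 => (He u N u0).1).
rewrite -/M -/S => low /(le_trans (ler_norm _)) up.
have {low up} : a * e * M <= K.
  apply: le_trans low _; apply: le_trans up; rewrite le_eqVlt; apply/orP; left; apply/eqP.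
  by apply: eq_bigr => -[n k] _ /=; rewrite Lc /d; ring.
move=> aeMK.
(* As [1/q + 1/t = 1], the factor [M ^ (1 / q)] in [a] cancels, and [a * e * M <= K] becomes a bound
   on [M ^ (1 / t)]. *)
have MqM : M = M `^ q^-1 * M `^ t^-1.
  by rewrite -powRD ?qt ?powRr1// oner_eq0.
have Mt : M `^ t^-1 <= C `^ 2^-1 / e * K.
  rewrite mulrAC ler_pdivlMr// -ler_pdivrMl ?powR_gt0//.
  apply: le_trans aeMK; rewrite [X in _ <= _ * X]MqM /a invfM le_eqVlt; apply/orP; left; apply/eqP.
  by field; rewrite !gt_eqF ?powR_gt0.
have -> : M = (M `^ t^-1) `^ t by rewrite -powRrM mulVf ?gt_eqF// powRr1.
apply: ge0_ler_powR; rewrite ?nnegrE ?powR_ge0 ?(ltW t0)//.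
exact: le_trans (powR_ge0 _ _) Mt.
Qed.

End DualBound.

(** * Density of finite Haar sums *)

Section Density.
Context {R : realType} (P : probability (full_line R) R).
Implicit Types (n m i N : nat) (k j : int) (x y a : R) (f g : process R)
  (c d : nat -> int -> R) (b : int -> R) (F : seq int) (S : seq (nat * int)).

Local Notation kn := dyadic_index.
Local Notation haar_var := (haar_var P).
Local Notation sqsum := (sqsum P).
Local Notation atom_power := (atom_power P).
Local Notation coef_norm := (coef_norm P).
Local Notation haar_process := (haar_process P).

Lemma powR_cvg0_seq (u : nat -> R) (b : R) : 0 < b -> (forall n, 0 <= u n) ->
  u @ \oo --> 0 -> (fun n => u n `^ b) @ \oo --> 0.
Proof.
move=> b0 u0 /cvgr0Pnorm_lt ul; apply/cvgr0Pnorm_lt => e e0.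
have eb : 0 < e `^ b^-1 by exact: powR_gt0.
near=> n; rewrite ger0_norm ?powR_ge0//.
have -> : e = (e `^ b^-1) `^ b by rewrite -powRrM mulVf ?gt_eqF// powRr1// ltW.
apply: gt0_ltr_powR => //; rewrite ?nnegrE ?powR_ge0//.
by rewrite -[u n]ger0_norm//; near: n; exact: ul.
Unshelve. all: by end_near. Qed.

Lemma poweR_cvg0_seq (u : nat -> \bar R) (b : R) : 0 < b -> (forall n, 0 <= u n)%E ->
  u @ \oo --> 0%E -> (fun n => u n `^ b)%E @ \oo --> 0%E.
Proof.
move=> b0 u0 /fine_cvgP[ufin ul]; apply/fine_cvgP; split.
  by apply: filterS ufin => n; exact: fin_num_poweR.
have -> : fine \o (fun n => u n `^ b)%E = fun n => (fine (u n)) `^ b.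
  by apply/funext => n /=; rewrite fine_poweR.
apply: powR_cvg0_seq => // n; exact: fine_ge0.
Qed.

Lemma esum_tail_small (e : int -> \bar R) (eps : R) : (forall j, 0 <= e j)%E ->
  (\esum_(j in [set: int]) e j < +oo)%E -> 0 < eps ->
  exists2 F : seq int, uniq F & (\esum_(j in ~` [set` F]) e j <= eps%:E)%E.
Proof.
move=> e0 efin eps0.
have Efin : (\esum_(j in [set: int]) e j)%E \is a fin_num.
  by rewrite ge0_fin_numE//; exact: esum_ge0.
have [_ [X [finX _] <-] XE] := ub_ereal_sup_adherent eps0 Efin.
exists (finmap.enum_fset (fset_set X)); first exact: finmap.fset_uniq.
have FX : [set` finmap.enum_fset (fset_set X)] = X.
  by rewrite -[RHS](fset_setK finX); apply/seteqP; split.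
rewrite FX.
have split_E := @esumID R int X [set: int] e (fun j _ => e0 j).
rewrite !setTI (esum_fset finX) in split_E; last by move=> j _; exact: e0.
move: XE; rewrite -/(esum _ _) split_E.
set A := (\sum_(i \in X) e i)%E; set B := (\esum_(j in ~` X) e j)%E.
have A0 : (0 <= A)%E by apply: fsume_ge0 => j _; exact: e0.
have Afin : A \is a fin_num.
  rewrite ge0_fin_numE//; apply: le_lt_trans efin; rewrite split_E leeDl//.
  by apply: esum_ge0 => j _; exact: e0.
move=> h; rewrite leNgt; apply/negP => epsB; move: h; rewrite ltNge => /negP; apply.
rewrite leeBrDr//; first by rewrite leeD2l// ltW.
Qed.

Definition tail_coef F N c n k : R :=
  if (n, k) \in key_pairs F N then 0 else c n k.

Lemma tail_coefE F N c :
  (fun n k => (-1) * restrict (key_pairs F N) c n k + c n k) = tail_coef F N c.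
Proof.
apply/funext => n; apply/funext => k; rewrite /restrict /tail_coef.
by case: ifP => _; rewrite ?mulr0 ?add0r// mulN1r addNr.
Qed.

Lemma sqsum_tail_le F N c x : (sqsum (tail_coef F N c) x <= sqsum c x)%E.
Proof.
apply: lee_nneseries => [n _ _|n _]; rewrite lee_fin ?sqsum_term_ge0// /tail_coef.
by case: ifP => // _; rewrite expr0n mul0r sqsum_term_ge0.
Qed.

Lemma sqsum_tailE F N c x : kn 0 x \in F -> sqsum (tail_coef F N c) x =
  (\sum_(N <= n <oo) (c n (kn n x) ^+ 2 * haar_var n (kn n x))%:E)%E.
Proof.
move=> xF; rewrite /sqsum (@nneseries_split _ _ 0 N); last first.
  by move=> n _; rewrite lee_fin sqsum_term_ge0.
rewrite add0n big_nat_cond big1 ?add0e; last first.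
  move=> n; rewrite andbT => /andP[_ nN].
  by rewrite /tail_coef (@mem_key_pairs R) nN dyadic_root_index xF/= expr0n mul0r.
apply: congr_lim; apply/funext => m; rewrite big_nat_cond [RHS]big_nat_cond.
apply: eq_bigr => n; rewrite andbT => /andP[Nn _].
by rewrite /tail_coef (@mem_key_pairs R) ltnNge Nn.
Qed.

(** Dominated convergence with majorant [sqsum c ^ (p / 2)]: its integrability makes [sqsum c]
    finite almost everywhere on [unit_itv j], and there the tails of the series tend to 0. *)
Lemma atom_power_tail_cvg p q F c j : 0 < p -> 0 < q -> j \in F ->
  (coef_norm p q c < +oo)%E ->
  (fun N => atom_power p (tail_coef F N c) j) @ \oo --> 0%E.
Proof.
move=> p0 q0 jF cfin; have p2 : 0 < p / 2 by rewrite divr_gt0.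
have mj := measurable_unit_itv (R:=R) j.
have msq d : measurable_fun (unit_itv j : set (full_line R)) (fun x : full_line R => (sqsum d x `^ (p / 2))%E).
  apply: measurable_funTS.
  exact: (measurableT_comp (measurable_poweR (p / 2)) (sqsum_measurable P d)).
have intg : P.-integrable (unit_itv j) (fun x : full_line R => (sqsum c x `^ (p / 2))%E).
  apply/integrableP; split => //.
  under eq_integral do rewrite gee0_abs ?poweR_ge0//.
  have := atom_power_fin j p0 q0 cfin.
  by rewrite ge0_fin_numE// atom_power_ge0.
have := @dominated_convergence _ _ R P (unit_itv j) mj
  (fun N x => (sqsum (tail_coef F N c) x `^ (p / 2))%E) (cst 0%E) _ (fun N => msq _)
  (measurable_cst _) _ intg _.
case.
- have [N0 [mN PN subN]] := integrable_ae mj intg.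
  exists N0; split => // x /= nx; apply: subN => /= fx; apply: nx => jx.
  have xF : kn 0 x \in F by move: jx; rewrite unit_itvE dyadic_itvE /= => ->.
  have sfin : (sqsum c x < +oo)%E.
    apply: (@lty_poweRy _ _ (p / 2)); first by rewrite gt_eqF.
    by rewrite -ge0_fin_numE ?poweR_ge0//; exact: fx.
  apply: poweR_cvg0_seq => //; first by move=> N; exact: sqsum_ge0.
  under eq_fun do rewrite (sqsum_tailE _ _ xF).
  apply: nneseries_tail_cvg => // n _; by rewrite lee_fin sqsum_term_ge0.
- apply: aeW => x N jx; rewrite gee0_abs ?poweR_ge0//.
  by apply: le0_poweR; rewrite ?(ltW p2)// ?sqsum_ge0// sqsum_tail_le.
by move=> _ _; rewrite integral0.
Qed.

Lemma coef_norm_density p q c (eps : R) : 0 < p -> 0 < q -> 0 < eps ->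
  (coef_norm p q c < +oo)%E ->
  exists F N, uniq F /\ (coef_norm p q (tail_coef F N c) <= eps%:E)%E.
Proof.
move=> p0 q0 eps0 cfin; have qp : 0 < q / p by rewrite divr_gt0.
(* Half of [eps ^ q] is for the intervals outside [F], half for the levels from [N] on inside [F];
   [F] is fixed before [N]. *)
pose del := eps `^ q / 2.
have del0 : 0 < del by rewrite divr_gt0// powR_gt0.
have [F uF tailF] := @esum_tail_small (fun j => (atom_power p c j `^ (q / p))%E) del
  (fun j => poweR_ge0 _ _) (coef_norm_esum_lty q0 cfin) del0.
have cvF : (fun N => \sum_(j <- F | j \in F) (atom_power p (tail_coef F N c) j `^ (q / p)))%E @ \oo
    --> (\sum_(j <- F | j \in F) (0 : \bar R))%E.
  apply: cvg_nnesum => j jF; first by apply: nearW => N; exact: poweR_ge0.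
  apply: poweR_cvg0_seq => //; first by move=> N; exact: atom_power_ge0.
  exact: (atom_power_tail_cvg p0 q0 jF cfin).
rewrite big1 // in cvF.
have [N _ /(_ N (leqnn N)) FN] : \forall N \near \oo,
    (\sum_(j <- F | j \in F) (atom_power p (tail_coef F N c) j `^ (q / p)) < del%:E)%E.
  apply: (cvF [set y | (y < del%:E)%E]); apply: open_nbhs_nbhs; split.
    exact: open_ereal_lt_ereal.
  by rewrite /= lte_fin.
rewrite -big_seq in FN.
exists F, N; split => //.
have -> : eps%:E = ((eps `^ q)%:E `^ q^-1)%E.
  by rewrite poweR_EFin -powRrM divff ?gt_eqF// powRr1// ltW.
apply: le0_poweR; first by rewrite invr_ge0 ltW.
  by apply: esum_ge0 => j _; exact: poweR_ge0.
rewrite (esumID [set` F]); last by move=> j _; exact: poweR_ge0.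
rewrite !setTI.
rewrite (_ : (eps `^ q)%:E = del%:E + del%:E)%E; last by rewrite -EFinD -splitr.
apply: leeD.
  have fF : finite_set [set` F] by exact: finite_seq.
  rewrite esum_fset//; last by move=> j _; exact: poweR_ge0.
  by rewrite -fsbig_seq// ltW.
apply: le_trans tailF; apply: le_esum => j _; apply: le0_poweR; first exact: ltW.
  exact: atom_power_ge0.
apply: ge0_le_integral.
- exact: measurable_unit_itv.
- by move=> x _; exact: poweR_ge0.
- by apply: measurable_funTS; exact: (measurableT_comp (measurable_poweR (p / 2)) (sqsum_measurable P _)).
- by apply: measurable_funTS; exact: (measurableT_comp (measurable_poweR (p / 2)) (sqsum_measurable P _)).
move=> x _; apply: le0_poweR; rewrite ?sqsum_ge0 ?sqsum_tail_le//.
by rewrite divr_ge0 ?ltW.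
Qed.

(** By linearity the functionals agree on finite Haar sums. The remainder [h] has the explicit
    coefficients [tail_coef], so its norm is estimated directly, without a triangle inequality. *)
Lemma Hs_dual_ext p q L1 L2 : 0 < p -> 0 < q ->
  Hs_dual P p q L1 -> Hs_dual P p q L2 ->
  (forall s, L1 (haar_process (delta_coef s)) = L2 (haar_process (delta_coef s))) ->
  forall f, Hs P p q f -> L1 f = L2 f.
Proof.
move=> p0 q0 D1 D2 eqD f Hf.
have [Lin1 [C1 B1]] := D1; have [Lin2 [C2 B2]] := D2.
have [mf fin_f] := Hf; have tf := martingale_tree mf.
pose c := haar_coef P f; have fc := represents_haar_coef tf.
have cfin : (coef_norm p q c < +oo)%E by rewrite -(Hs_normE p q tf fc).
apply/eqP; rewrite -subr_eq0 -normr_le0; apply/ler_addgt0Pr => eps eps0; rewrite add0r.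
(* The summand 1 keeps [K] positive, and [(|C1| + |C2|) * (eps / K) <= eps]. *)
pose K := `|C1| + `|C2| + 1.
have K0 : 0 < K by rewrite ltr_wpDl// addr_ge0.
have [F [N [uF small]]] := coef_norm_density p0 q0 (divr_gt0 eps0 K0) cfin.
pose g := haar_process (restrict (key_pairs F N) c).
have Hg : Hs P p q g by apply: Hs_haar; exact: coef_norm_restrict.
pose h : process R := fun n x => (-1) * g n x + f n x.
have th : tree_martingale P h by apply: tree_martingale_lin => //; exact: tree_martingale_haar.
have hr : represents P h (tail_coef F N c).
  by rewrite -tail_coefE; apply: represents_lin => //; exact: represents_haar.
have hn : (Hs_norm P p q h <= (eps / K)%:E)%E by rewrite (Hs_normE p q th hr).
have Hh : Hs P p q h.
  by split; [exact/tree_martingaleP|exact: le_lt_trans hn (ltry _)].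
have fE : f = (fun n x => 1 * h n x + g n x).
  by apply/funext => n; apply/funext => x; rewrite /h; ring.
have gE : L1 g = L2 g.
  rewrite /g (Hs_dual_restrict _ D1 p0 q0 (key_pairs_uniq N uF)).
  rewrite (Hs_dual_restrict _ D2 p0 q0 (key_pairs_uniq N uF)).
  by apply: eq_bigr => s _; rewrite eqD.
rewrite fE Lin1// Lin2// !mul1r gE opprD addrACA subrr addr0.
have bnd (L : process R -> R) (C : R) : (forall f, Hs P p q f -> (`|L f|%:E <= C%:E * Hs_norm P p q f)%E) ->
    `|L h| <= `|C| * (eps / K).
  move=> /(_ h Hh) Lh; rewrite -lee_fin; apply: (le_trans Lh).
  have n0 : (0 <= Hs_norm P p q h)%E by exact: poweR_ge0.
  apply: (@le_trans _ _ (`|C|%:E * Hs_norm P p q h)%E).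
    by apply: lee_wpmul2r => //; rewrite lee_fin ler_norm.
  by rewrite EFinM; apply: lee_wpmul2l; rewrite ?lee_fin.
apply: (le_trans (ler_normB _ _)); apply: (le_trans (lerD (bnd _ _ B1) (bnd _ _ B2))).
rewrite -mulrDl mulrCA ger_pMr// ler_pdivrMr// mul1r /K.
by rewrite lerDl.
Qed.

End Density.

(** * The duality pairing *)

Section Pairing.
Context {R : realType} (P : probability (full_line R) R).
Implicit Types (n m i N : nat) (k j : int) (x y a : R) (f g h : process R)
  (c d : nat -> int -> R).

Local Notation kn := dyadic_index.
Local Notation mass := (mass P).
Local Notation haar_var := (haar_var P).
Local Notation haar_process := (haar_process P).
Local Notation Hs := (Hs P).
Local Notation Hs_norm := (Hs_norm P).
Local Notation mpairing := (mpairing P).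

Lemma Hs_tree p q f : Hs p q f -> tree_martingale P f.
Proof. by move=> [/martingale_tree]. Qed.

Lemma Hs_norm_ge0 p q f : (0 <= Hs_norm p q f)%E.
Proof. exact: poweR_ge0. Qed.

Lemma Hs_norm_fin p q f : Hs p q f -> Hs_norm p q f \is a fin_num.
Proof. by move=> [_ fin]; rewrite ge0_fin_numE// Hs_norm_ge0. Qed.

Lemma mpairing_sym f g : mpairing g f = mpairing f g.
Proof.
congr (limn (series _)); apply/funext => n; congr Rintegral.
by apply/funext => x; rewrite mulrC.
Qed.

Section Conjugate.
Variables (p q r t : R).
Hypotheses (p0 : 0 < p) (q0 : 0 < q) (r0 : 0 < r) (t0 : 0 < t).
Hypotheses (pr : p^-1 + r^-1 = 1) (qt : q^-1 + t^-1 = 1).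

Lemma mpairing_abs_le f g : Hs p q f -> Hs r t g ->
  (\sum_(0 <= n <oo) \int[P]_x `|mdiff f n x * mdiff g n x|%:E <=
   Hs_norm p q f * Hs_norm r t g)%E.
Proof.
move=> Hf Hg; have tf := Hs_tree Hf; have tg := Hs_tree Hg.
have fc := represents_haar_coef tf; have gd := represents_haar_coef tg.
have A0 n : (0 <= \int[P]_x `|mdiff f n x * mdiff g n x|%:E)%E.
  by apply: integral_ge0 => x _; rewrite lee_fin.
(* The term [n = 0] vanishes since [d_0 f = 0]; the shift by one then matches the difference [n + 1]
   with the coefficient of level [n]. *)
rewrite nneseries_recl// [X in (X + _)%E]integral0_eq ?add0e; last first.
  by move=> x _ /=; rewrite mul0r normr0.
rewrite -nneseries_addn// (Hs_normE p q tf fc) (Hs_normE r t tg gd).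
have -> : (\sum_(n <oo) \int[P]_x `|mdiff f (n + 1) x * mdiff g (n + 1) x|%:E =
    \sum_(n <oo) \int[P]_x (`|haar_coef P f n (kn n x) * haar_coef P g n (kn n x)| * haar_var n (kn n x))%:E)%E.
  by apply: eq_eseriesr => n _; rewrite addn1; exact: integral_mdiff_abs.
apply: pairing_bound => //.
- by rewrite -(Hs_normE p q tf fc); case: Hf.
- by rewrite -(Hs_normE r t tg gd); case: Hg.
Qed.

Lemma mpairing_abs_lty f g : Hs p q f -> Hs r t g ->
  (\sum_(0 <= n <oo) \int[P]_x `|mdiff f n x * mdiff g n x|%:E < +oo)%E.
Proof.
move=> Hf Hg; apply: le_lt_trans (mpairing_abs_le Hf Hg) _.
by rewrite -ge0_fin_numE ?mule_ge0 ?Hs_norm_ge0// fin_numM ?(Hs_norm_fin Hf) ?(Hs_norm_fin Hg).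
Qed.

Lemma mpairing_integrable f g n : Hs p q f -> Hs r t g ->
  P.-integrable setT (EFin \o (fun x : full_line R => mdiff f n x * mdiff g n x)).
Proof.
move=> Hf Hg; apply/integrableP; split.
  by apply/measurable_EFinP; apply: measurable_funM; apply: mdiff_measurable; [exact: Hs_tree Hf|exact: Hs_tree Hg].
apply: le_lt_trans (mpairing_abs_lty Hf Hg).
have := @nneseries_lim_ge R (fun n => \int[P]_x `|mdiff f n x * mdiff g n x|%:E)%E xpredT 0%N n.+1.
rewrite big_nat_recr //= => H; apply: le_trans (H _) => [|m _ _]; last first.
  by apply: integral_ge0 => x _; rewrite lee_fin.
by rewrite leeDr// sume_ge0// => m _; apply: integral_ge0 => x _; rewrite lee_fin.
Qed.

Let u f g n := Rintegral P [set: full_line R] (fun x => mdiff f n x * mdiff g n x).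

Lemma mpairing_normed_le f g N : Hs p q f -> Hs r t g ->
  [normed series (u f g)] N <= fine (Hs_norm p q f * Hs_norm r t g)%E.
Proof.
move=> Hf Hg.
have fin : (Hs_norm p q f * Hs_norm r t g)%E \is a fin_num.
  by rewrite fin_numM ?(Hs_norm_fin Hf) ?(Hs_norm_fin Hg).
rewrite -lee_fin fineK//; apply: le_trans (mpairing_abs_le Hf Hg).
apply: le_trans (@nneseries_lim_ge R _ xpredT 0%N N _); last first.
  by move=> n _ _; apply: integral_ge0 => x _; rewrite lee_fin.
rewrite /series /= -sumEFin; apply: lee_sum => n _.
have := le_normr_Rintegral measurableT (mpairing_integrable n Hf Hg).
rewrite -lee_fin /= => /le_trans; apply.
rewrite /Rintegral fineK//.
have /integrable_norm/integrable_fin_num := mpairing_integrable n Hf Hg.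
exact.
Qed.

Lemma mpairing_cvg f g : Hs p q f -> Hs r t g -> cvgn (series (u f g)).
Proof.
move=> Hf Hg; apply: normed_cvg; apply: nondecreasing_is_cvgn.
  by apply: nondecreasing_series => n _ _; exact: normr_ge0.
exists (fine (Hs_norm p q f * Hs_norm r t g)%E) => _ [N _ <-].
exact: mpairing_normed_le.
Qed.

Lemma mpairing_le f g : Hs p q f -> Hs r t g ->
  (`|mpairing g f|%:E <= Hs_norm p q f * Hs_norm r t g)%E.
Proof.
move=> Hf Hg.
have fin : (Hs_norm p q f * Hs_norm r t g)%E \is a fin_num.
  by rewrite fin_numM ?(Hs_norm_fin Hf) ?(Hs_norm_fin Hg).
have cn : cvgn [normed series (u f g)].
  apply: nondecreasing_is_cvgn.
    by apply: nondecreasing_series => n _ _; exact: normr_ge0.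
  exists (fine (Hs_norm p q f * Hs_norm r t g)%E) => _ [N _ <-].
  exact: mpairing_normed_le.
rewrite -(fineK fin) lee_fin; apply: le_trans (lim_series_norm cn) _.
by apply: limr_le => //; apply: nearW => N; exact: mpairing_normed_le.
Qed.

Lemma mdiff_lin a f g n x :
  mdiff (fun n x => a * f n x + g n x) n x = a * mdiff f n x + mdiff g n x.
Proof. by case: n => [|n] /=; ring. Qed.

Lemma mpairing_linr a f1 f2 g : Hs p q f1 -> Hs p q f2 -> Hs r t g ->
  mpairing g (fun n x => a * f1 n x + f2 n x) = a * mpairing g f1 + mpairing g f2.
Proof.
move=> H1 H2 Hg; rewrite /Defs.mpairing.
have -> : (fun n => Rintegral P [set: full_line R]
      (fun x => mdiff (fun n x => a * f1 n x + f2 n x) n x * mdiff g n x)) =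
    (fun n => a * u f1 g n + u f2 g n).
  apply/funext => n.
  have i1 := mpairing_integrable n H1 Hg; have i2 := mpairing_integrable n H2 Hg.
  rewrite /u -RintegralZl// -RintegralD//; last exact: (integrableZl measurableT a i1).
  by apply: eq_Rintegral => x _; rewrite mdiff_lin mulrDl mulrA.
apply/cvg_lim => //.
have -> : series (fun n => a * u f1 g n + u f2 g n) =
    (fun n => a * series (u f1 g) n + series (u f2 g) n).
  by apply/funext => N; rewrite /series /= big_split mulr_sumr.
apply: cvgD; last exact: mpairing_cvg.
by apply: cvgMr; exact: mpairing_cvg.
Qed.

Lemma mpairing_dual g : Hs r t g -> Hs_dual P p q (mpairing g).
Proof.
move=> Hg; split; first by move=> a f1 f2 H1 H2; exact: mpairing_linr.
exists (fine (Hs_norm r t g)) => f Hf.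
by rewrite fineK ?(Hs_norm_fin Hg)// muleC; exact: mpairing_le.
Qed.

(** The Haar process of [(n, k)] has a single nonzero difference, that of index [n.+1], so the
    series is constant from [n.+2] terms on. Pairing against these processes recovers the
    coefficients of [g]. *)
Lemma mpairing_delta g d n k : Hs r t g -> represents P g d ->
  mpairing g (haar_process (delta_coef (n, k))) = d n k * haar_var n k * mass n k.
Proof.
move=> Hg gd; have tg := Hs_tree Hg.
set f := haar_process _.
have tf : tree_martingale P f by exact: tree_martingale_haar.
have fc : represents P f (delta_coef (n, k)) by exact: represents_haar.
set v := d n k * haar_var n k * mass n k.
have uE m : u f g m = if m == n.+1 then v else 0.
  case: m => [|m]; first by rewrite /u /Rintegral integral0_eq// => x _ /=; rewrite mul0r.
  rewrite eqSS /u /Rintegral (integral_mdiff m tf tg fc gd) /delta_coef.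
  case: eqVneq => [->|mn].
    rewrite -[v]/(fine v%:E); congr fine.
    rewrite /v EFinM -(@integral_dyadic_itv_cst _ P n k (cst (d n k * haar_var n k)%:E))//.
    rewrite [RHS]integral_mkcond; apply: eq_integral => x _.
    rewrite patchE dyadic_itvE /= xpair_eqE eqxx/=.
    have [xk|xk] := eqVneq (kn n x) k; first by rewrite mem_set// mul1r xk.
    by rewrite memNset ?mul0r ?mul0r//; exact/eqP.
  rewrite integral0_eq// => x _.
  by rewrite xpair_eqE (negbTE mn)/= !mul0r.
apply: lim_near_cst => //; exists n.+2 => // N /= nN.
rewrite /series /= -/(u f g) (eq_bigr (fun m => if m == n.+1 then v else 0)) => [|m _]; last exact: uE.
by rewrite -big_mkcond big_nat1_eq /= nN.
Qed.

End Conjugate.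
End Pairing.

(** * Functionals and their values on Haar functions *)

Section HaarFunctionals.
Context {R : realType} (P : probability (full_line R) R).
Implicit Types (n : nat) (k : int) (p q : R) (f g h : process R) (c d : nat -> int -> R).

Local Notation kn := dyadic_index.

Lemma coef_norm_eq0 p q c : 0 < p -> 0 < q -> (forall x, sqsum P c x = 0%E) ->
  coef_norm P p q c = 0%E.
Proof.
move=> p0 q0 c0; rewrite /coef_norm esum1 ?poweR0r ?invr_neq0 ?gt_eqF// => j _.
rewrite /atom_power integral0_eq ?poweR0r ?gt_eqF ?divr_gt0// => x _.
by rewrite c0 poweR0r ?gt_eqF ?divr_gt0.
Qed.

Lemma Hs_norm0 p q : 0 < p -> 0 < q -> Hs_norm P p q (fun _ _ => 0) = 0%E.
Proof.
move=> p0 q0; rewrite -(haar_process0 P).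
rewrite (Hs_normE p q (tree_martingale_haar P _) (@represents_haar R P _)).
apply: coef_norm_eq0 => // x; apply: eseries0 => n _ _.
by rewrite expr0n mul0r.
Qed.

Lemma coef_norm_delta0 p q n k : 0 < p -> 0 < q -> haar_var P n k = 0 ->
  coef_norm P p q (delta_coef (n, k)) = 0%E.
Proof.
move=> p0 q0 v0; apply: coef_norm_eq0 => // x; apply: eseries0 => m _ _.
rewrite /delta_coef; case: eqP => [[-> ->]|_]; first by rewrite v0 mulr0.
by rewrite expr0n mul0r.
Qed.

(** A bounded functional vanishes on processes of norm zero, such as a Haar process whose only
    coefficient sits where [haar_var] is 0. *)
Lemma Hs_dual_delta0 p q L n k : 0 < p -> 0 < q -> Hs_dual P p q L ->
  haar_var P n k = 0 -> L (haar_process P (delta_coef (n, k))) = 0.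
Proof.
move=> p0 q0 [_ [C LC]] v0; apply/eqP; rewrite -normr_le0 -lee_fin.
apply: (le_trans (LC _ (Hs_delta P (n, k) p0 q0))).
rewrite (Hs_normE p q (tree_martingale_haar P _) (@represents_haar R P _)).
by rewrite coef_norm_delta0// mule0.
Qed.

Lemma mass_haar_var0 n k : mass P n k = 0 -> haar_var P n k = 0.
Proof.
rewrite massS => /eqP; rewrite paddr_eq0 ?mass_ge0// => /andP[/eqP l0 _].
by rewrite /haar_var l0 mul0r.
Qed.

(** Solving for [c] divides by [haar_var * mass]. If [haar_var] is 0 then both sides are 0, and
    otherwise the mass is nonzero as well. *)
Lemma Hs_dual_coef p q L : 0 < p -> 0 < q -> Hs_dual P p q L ->
  exists c, forall n k,
    L (haar_process P (delta_coef (n, k))) = c n k * haar_var P n k * mass P n k.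
Proof.
move=> p0 q0 LD; exists (fun n k => L (haar_process P (delta_coef (n, k))) /
  (haar_var P n k * mass P n k)) => n k.
have [v0|v0] := eqVneq (haar_var P n k) 0.
  by rewrite (Hs_dual_delta0 p0 q0 LD v0) v0 !mul0r.
have m0 : mass P n k != 0 by apply: contra_neq v0; exact: mass_haar_var0.
by rewrite -mulrA divfK// mulf_neq0.
Qed.

(** Coefficients are determined only where [haar_var] is nonzero. If it is 0 around a regular [x],
    the child containing [x] has positive mass, so its sibling is null and [haar n x], which is the
    sibling's mass up to sign, is 0. *)
Lemma represents_indistinct g h c d : tree_martingale P g -> tree_martingale P h ->
  represents P g c -> represents P h d ->
  (forall n k, c n k * haar_var P n k * mass P n k = d n k * haar_var P n k * mass P n k) ->
  indistinct P g h.
Proof.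
move=> [g0 _ _] [h0 _ _] gc hd cd n; apply: regular_ae => x rx.
elim: n => [|n IH]; first by rewrite g0 h0.
suff : mdiff g n.+1 x = mdiff h n.+1 x by rewrite /= IH => /addIr.
rewrite gc// hd//; set k := kn n x.
have [v0|v0] := eqVneq (haar_var P n k) 0; last first.
  congr (_ * _); apply: (mulIf v0); apply: (mulIf (rx n)); exact: cd.
suff -> : haar P n x = 0 by rewrite !mulr0.
have := rx n.+1; move/eqP: v0; rewrite mulf_eq0.
have [xk|xk] := dyadic_indexS n x; rewrite xk -/k => /orP[/eqP l0|/eqP l0].
- by rewrite l0 eqxx.
- by rewrite (haar_left P xk).
- by rewrite (haar_right P xk) l0 oppr0.
- by rewrite l0 eqxx.
Qed.

End HaarFunctionals.

(** * The identification of the dual space *)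

Theorem theorem3p4 (R : realType) (P : probability (full_line R) R)
    (p q p' q' : R)
    (hpq : (1 < q /\ q <= p /\ p <= 2) \/ (2 <= p /\ p <= q))
    (hp' : p^-1 + p'^-1 = 1) (hq' : q^-1 + q'^-1 = 1) :
  Hs_dual_identifies_with P p q p' q'.
Proof.
have [p1 q1] : 1 < p /\ 1 < q by lra.
have conj_gt1 (a b : R) : 1 < a -> a^-1 + b^-1 = 1 -> 1 < b.
  move=> a1 ab; have a0 : 0 < a by exact: lt_trans a1.
  have ai : 0 < a^-1 < 1 by rewrite invr_gt0 a0 invf_lt1.
  have b0 : 0 < b by rewrite -invr_gt0; lra.
  by rewrite -invf_lt1//; lra.
have p'1 := conj_gt1 _ _ p1 hp'; have q'1 := conj_gt1 _ _ q1 hq'.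
have [p0 q0 p'0 q'0] : [/\ 0 < p, 0 < q, 0 < p' & 0 < q'].
  by split; apply: lt_trans (ltr01) _.
have [hp hq] : p'^-1 + p^-1 = 1 /\ q'^-1 + q^-1 = 1 by split; rewrite addrC.
have [D D0 HD] := dual_bound P p1 q1 p'1 q'1 hp' hq'.
have dualg g : Hs P p' q' g -> Hs_dual P p q (mpairing P g) by exact: mpairing_dual.
split.
- by move=> f g Hf Hg; exact: (mpairing_abs_lty p0 q0 p'0 q'0 hp' hq' Hf Hg).
- exact: dualg.
(* Linearity in [g] is linearity in [f] after exchanging the two pairs of exponents. *)
- move=> a g h f Hg Hh Hf; rewrite !(mpairing_sym P f).
  by rewrite (@mpairing_linr R P p' q' p q).
- split=> [L LD|g h Hg Hh gh]; last first.
    have tg := Hs_tree Hg; have th := Hs_tree Hh.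
    have gc := represents_haar_coef tg; have hd := represents_haar_coef th.
    apply: (represents_indistinct tg th gc hd) => n k.
    rewrite -(@mpairing_delta R P p' q' g _ n k Hg gc) -(@mpairing_delta R P p' q' h _ n k Hh hd).
    by apply: gh; exact: Hs_delta.
  have [c cE] := Hs_dual_coef p0 q0 LD.
  have [_ [C LC]] := LD.
  (* [dual_bound] with [K = |C|]; the absolute value is taken because the sign of [C] is unknown. *)
  have Hg : Hs P p' q' (haar_process P c).
    apply: Hs_haar; apply: le_lt_trans (HD L c `|C| LD cE (normr_ge0 _) _) (ltry _).
    move=> f Hf f1; rewrite -lee_fin; apply: (le_trans (LC f Hf)).
    apply: (@le_trans _ _ (`|C|%:E * Hs_norm P p q f)%E).
      by apply: lee_wpmul2r; rewrite ?Hs_norm_ge0// lee_fin ler_norm.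
    by rewrite -[leRHS]mule1; apply: lee_wpmul2l => //; rewrite lee_fin.
  exists (haar_process P c) => // f Hf.
  apply: (@Hs_dual_ext R P p q L (mpairing P (haar_process P c)) p0 q0 LD (dualg _ Hg)) => // -[n k].
  by rewrite cE (@mpairing_delta R P p' q' _ _ n k Hg (@represents_haar R P c)).
(* The upper constant 1 comes from the Hoelder bound of the pairing, the lower one from [dual_bound]
   with [K] the dual norm itself. *)
exists D^-1, 1; split => [||g Hg]; rewrite ?invr_gt0//.
have up : (Hs_dual_norm P p q (mpairing P g) <= Hs_norm P p' q' g)%E.
  apply: ge_ereal_sup => _ [f [Hf f1] <-].
  apply: (le_trans (mpairing_le p0 q0 p'0 q'0 hp' hq' Hf Hg)).
  by rewrite -[leRHS]mul1e; apply: lee_wpmul2r => //; exact: Hs_norm_ge0.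
split; last by rewrite mul1e.
(* The zero process lies in the unit ball, so the supremum is over a nonempty set. *)
have K0 : (0 <= Hs_dual_norm P p q (mpairing P g))%E.
  apply: (@le_trans _ _ `|mpairing P g (fun _ _ => 0)|%:E); first by rewrite lee_fin.
  by apply: ereal_sup_ubound; exists (fun _ _ => 0) => //=; split; [exact: Hs0|rewrite Hs_norm0].
have Kfin : Hs_dual_norm P p q (mpairing P g) \is a fin_num.
  by rewrite ge0_fin_numE// (le_lt_trans up)// -ge0_fin_numE ?Hs_norm_ge0// (Hs_norm_fin Hg).
have tg := Hs_tree Hg; have gd := represents_haar_coef tg.
have := HD (mpairing P g) (haar_coef P g) (fine (Hs_dual_norm P p q (mpairing P g))) (dualg _ Hg).
rewrite -(Hs_normE p' q' tg gd) EFinM fineK// => low.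
rewrite lee_pdivrMl//; apply: low.
- by move=> n k; exact: (@mpairing_delta R P p' q' g _ n k Hg gd).
- exact: fine_ge0.
move=> f Hf f1; rewrite -lee_fin fineK//.
by apply: ereal_sup_ubound; exists f.
Qed.
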